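(* Let $p\ge 2$ and $q\ge 1$ be integers, let $\sigma\in\mathbb{C}$, and let $Z_\sigma^{[p,q]}(\alpha)$, $\alpha\in\mathbb{R}$, be the zonal spherical function of the group $SO_0(p,q)$ defined in the context. Then for all $\alpha\in\mathbb{R}$ $$Z_{\sigma}^{[p,q]}(\alpha)=\frac{1}{\cosh\alpha}\sum_{m,n=0}^{\infty}\frac{\left(-\frac{\sigma}{2}\right)_m\left(1-\frac{\sigma+q}{2}\right)_m\left(\frac{\sigma+q}{2}\right)_n\left(\frac12\right)_{m+n}}{\left(\frac q2\right)_{m+n}\left(\frac p2\right)_m}\,\frac{(\tanh^2\alpha)^{m}}{m!}\,\frac{(\tanh^2\alpha)^{n}}{n!}$$ and also $$Z_{\sigma}^{[p,q]}(\alpha)=\frac{1}{\cosh\alpha}\sum_{m,n=0}^{\infty}\frac{\left(-\frac{\sigma}{2}\right)_m\left(1-\frac{\sigma+p}{2}\right)_m\left(\frac{\sigma+p}{2}\right)_n\left(\frac12\right)_{m+n}}{\left(\frac p2\right)_{m+n}\left(\frac q2\right)_m}\,\frac{(\tanh^2\alpha)^{m}}{m!}\,\frac{(\tanh^2\alpha)^{n}}{n!}.$$ That is, the zonal spherical functions of all these groups are expressed through a generalized hypergeometric (Horn) series of two variables, evaluated at $(\tanh^2\alpha,\tanh^2\alpha)$.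
   Context: $(a)_n=a(a+1)\cdots(a+n-1)$, $(a)_0=1$, is the Pochhammer symbol. $SO_0(p,q)$ is the identity component of the group of linear transformations of $\mathbb{R}^{p+q}$ preserving $[k,k]=k_1^2+\dots+k_q^2-k_{q+1}^2-\dots-k_{p+q}^2$. For $\sigma\in\mathbb{C}$ it acts by $T^{(\sigma)}(g)F(k)=F(g^{-1}k)$ on smooth functions on the cone $[k,k]=0$, $k\ne0$, that satisfy $F(ak)=|a|^\sigma F(k)$ for $a\neq 0$. Such functions are identified with their restrictions to $S^{q-1}\times S^{p-1}$, i.e. to $k_1^2+\dots+k_q^2=k_{q+1}^2+\dots+k_{p+q}^2=1$. The zonal spherical function $Z_\sigma^{[p,q]}(\alpha)$ is the matrix element $\int (T^{(\sigma)}(g_\alpha)\mathbf 1)$ of the hyperbolic rotation $g_\alpha$ by $\alpha$ in the plane $(k_1,k_{p+q})$ with respect to the $SO(p)\otimes SO(q)$-invariant vector $\mathbf 1$, normalized so that $Z_\sigma^{[p,q]}(0)=1$. Explicitly, $$Z_\sigma^{[p,q]}(\alpha)=\int_{S^{q-1}}\int_{S^{p-1}}\Lambda(\alpha;x,y)^{\sigma/2},\qquad \Lambda(\alpha;x,y)=1+(x^2+y^2)\sinh^2\alpha-2xy\sinh\alpha\cosh\alpha>0,$$ where the integrals are with respect to the rotation-invariant probability measures on $S^{p-1}$ and $S^{q-1}$ ($S^0=\{\pm1\}$), $y=k_1$ is a coordinate of the point of $S^{q-1}\subset\mathbb{R}^q$, and $x=k_{p+q}$ is a coordinate of the point of $S^{p-1}\subset\mathbb{R}^p$.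 In particular: - for $p\ge q\ge3$: $Z_\sigma^{[p,q]}(\alpha)=\frac{\Gamma(p/2)\Gamma(q/2)}{\pi\Gamma(\frac{p-1}2)\Gamma(\frac{q-1}2)}\int_{-1}^1\int_{-1}^1\Lambda^{\sigma/2}(1-x^2)^{\frac{p-3}2}(1-y^2)^{\frac{q-3}2}\,dx\,dy$; - for $p\ge3$, $q=2$: $Z_\sigma^{[p,2]}(\alpha)=\frac{\Gamma(p/2)}{2\pi^{3/2}\Gamma(\frac{p-1}2)}\int_0^{2\pi}\int_{-1}^1\Lambda^{\sigma/2}(1-x^2)^{\frac{p-3}2}\,dx\,d\phi$ with $y=\cos\phi$; - for $p=q=2$: $Z_\sigma^{[2,2]}(\alpha)=\frac1{4\pi^2}\int_0^{2\pi}\int_0^{2\pi}\Lambda^{\sigma/2}\,d\phi\,d\chi$ with $y=\cos\phi$, $x=\cos\chi$. *)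

(* Defs.v *)
From HB Require Import structures.
From mathcomp Require Import all_boot all_order all_algebra finmap.
From mathcomp Require Import all_classical all_reals all_analysis.
From mathcomp Require Import measurable_realfun complex ring lra.
From mathcomp.analysis.showcase Require Import summability.

Set Implicit Arguments.
Unset Strict Implicit.
Unset Printing Implicit Defensive.

Import Order.TTheory GRing.Theory Num.Theory.
Import numFieldNormedType.Exports.

Local Open Scope classical_set_scope.
Local Open Scope ring_scope.

Section sphere.
Variable R : realType.

Definition sphere (n : nat) : set (n.-tuple R) :=
  [set t | \sum_(i < n) tnth t i ^+ 2 = 1].
Arguments sphere : clear implicits.

Definition mx_act (n : nat) (Q : 'M[R]_n) (t : n.-tuple R) : n.-tuple R :=
  [tuple \sum_(j < n) Q i j * tnth t j | i < n].

(* For n >= 2 invariance under O(n) is the same as invariance under SO(n); for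
   n = 1 the group SO(1) is trivial, and O(1) gives mass 1/2 to each of 1, -1. *)
Definition rotation_invariant_on_sphere (n : nat) (mu : probability (n.-tuple R) R) : Prop :=
  mu (sphere n) = 1%E /\
  forall Q : 'M[R]_n, Q^T *m Q = 1%:M ->
  forall A : set (n.-tuple R), measurable A -> mu (mx_act Q @^-1` A) = mu A.

End sphere.
Arguments sphere : clear implicits.

(* Existence of the rotation-invariant probability measure on the sphere, by
   radial projection of Lebesgue measure on the punctured unit ball. *)
Section sphere_existence.
Variable R : realType.
Implicit Types n : nat.

Lemma pushforward_measure d1 d2 (T1 : measurableType d1) (T2 : measurableType d2)
    (m : {measure set T1 -> \bar R}) (f : T1 -> T2) : measurable_fun setT f ->
  exists m' : {measure set T2 -> \bar R}, forall A, m' A = m (f @^-1` A).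
Proof.
move=> mf.
by exists (measure_function_pushforward__canonical__measure_function_Measure m mf).
Qed.

Lemma sigma_finite_pack d (T : measurableType d) (m : {measure set T -> \bar R}) :
  sigma_finite setT m ->
  exists m' : {sigma_finite_measure set T -> \bar R}, forall A, m' A = m A.
Proof.
move=> sm; have sf := @sfinite_measure_sigma_finite _ _ _ m sm.
pose i := @isSigmaFinite.Build _ _ _ m sm.
pose m' : {sigma_finite_measure set T -> \bar R} :=
  HB.pack (m : set T -> \bar R) (Measure.class m) i
    (isSFinite.Build _ _ _ (m : set T -> \bar R) sf).
by exists m'.
Qed.

Definition scales_by d (T : measurableType d) (mu : set T -> \bar R) (f : T -> T)
    (c : R) : Prop :=
  forall A, measurable A -> mu (f @^-1` A) = (c%:E * mu A)%E.

Lemma lebesgue_line : exists m : {sigma_finite_measure set R -> \bar R},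
  (forall a b, a <= b -> m `[a, b]%classic = (b - a)%:E) /\
  (forall a b, a != 0 -> scales_by m (fun x : R => a * x + b) `|a|^-1).
Proof.
have mid : measurable_fun [set: measurableTypeR R] (idfun : measurableTypeR R -> R).
  by move=> _ A mA; rewrite setTI.
have [m0 m0E] := pushforward_measure (@lebesgue_measure R) mid.
have {}m0E A : m0 A = lebesgue_measure A by rewrite m0E.
have sm0 : sigma_finite setT m0.
  have [F FT mF] := sigma_finiteT (@lebesgue_measure R).
  by exists F => // i; have [? ?] := mF i; split; rewrite // m0E.
have [m mE] := sigma_finite_pack sm0.
have {}mE A : m A = lebesgue_measure A by rewrite mE m0E.
exists m; split=> [a b|a b a0].
  move=> ab; rewrite (_ : m _ = lebesgue_measure `[a, b]%classic); last exact: mE.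
  rewrite lebesgue_measure_itv /= lte_fin.
  by move: ab; rewrite le_eqVlt => /predU1P[->|->//]; rewrite ltxx subrr.
have mf : measurable_fun [set: R] (fun x : R => a * x + b : measurableTypeR R).
  by apply: measurable_funD => //; exact: measurable_funM.
have a0' : 0 <= `|a| by [].
have [pf pfE] := pushforward_measure m mf.
have K A : measurable A -> lebesgue_measure A = (`|a|%:E * pf A)%E.
  move=> mA.
  pose mm : {measure set (measurableTypeR R) -> \bar R} := mscale (NngNum a0') pf.
  rewrite (@lebesgue_measure_unique R mm) // => X /ocitvP[->|[[c d] /= cd ->]].
    by rewrite !measure0.
  rewrite /mm /mscale /= pfE.
  rewrite [X in (_ * X)%E](_ : _ = lebesgue_measure ((fun x : R => a * x + b) @^-1` `]c, d]));
    last exact: mE.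
  rewrite lebesgue_measure_itv /= lte_fin cd.
  have [ap|an] := ltP 0 a.
    have -> : (fun x : R => a * x + b) @^-1` `]c, d] = `](c - b) / a, (d - b) / a]%classic.
      apply/seteqP; split => x /=; rewrite !in_itv /= ltr_pdivrMr // ler_pdivlMr // => /andP[? ?].
        by apply/andP; split; lra.
      by apply/andP; split; lra.
    rewrite lebesgue_measure_itv /= lte_fin ltr_pM2r ?invr_gt0 // ltrD2r cd.
    rewrite -!EFinD -EFinM; congr EFin; rewrite gtr0_norm //; field.
    exact: lt0r_neq0.
  have {}an : a < 0 by rewrite lt_neqAle a0.
  have -> : (fun x : R => a * x + b) @^-1` `]c, d] = `[(d - b) / a, (c - b) / a[%classic.
    apply/seteqP; split => x /=; rewrite !in_itv /= ltr_ndivlMr // ler_ndivrMr // => /andP[? ?].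
      by apply/andP; split; lra.
    by apply/andP; split; lra.
  rewrite lebesgue_measure_itv /= lte_fin ltr_nM2r ?invr_lt0 // ltrD2r cd.
  rewrite -!EFinD -EFinM; congr EFin; rewrite ltr0_norm //; field.
  exact: ltr0_neq0.
move=> A mA; rewrite (_ : m A = lebesgue_measure A); last exact: mE.
rewrite (K _ mA) pfE muleA -EFinM mulVf ?normr_eq0 //.
by rewrite mul1e.
Qed.

Definition shift_tuple n (v t : n.-tuple R) : n.-tuple R :=
  [tuple tnth t i + tnth v i | i < n].

Lemma measurable_tnth' n (i : 'I_n) :
  measurable_fun [set: n.-tuple R] (fun t : n.-tuple R => tnth t i).
Proof. exact: measurable_tnth. Qed.

Lemma measurable_lin n (u : 'I_n -> R) :
  measurable_fun [set: n.-tuple R] (fun t : n.-tuple R => \sum_(j < n) u j * tnth t j).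
Proof.
apply: measurable_sum => j; apply: measurable_funM => //.
exact: measurable_tnth'.
Qed.

Lemma measurable_mx_act n (Q : 'M[R]_n) : measurable_fun setT (mx_act Q).
Proof.
apply/measurable_fun_tnthP => i.
rewrite (_ : _ \o _ = fun t : n.-tuple R => \sum_(j < n) Q i j * tnth t j).
  exact: measurable_lin.
by apply/funext => t /=; rewrite tnth_mktuple.
Qed.

Lemma mx_actM n (P Q : 'M[R]_n) t : mx_act (P *m Q) t = mx_act P (mx_act Q t).
Proof.
apply: eq_from_tnth => i; rewrite !tnth_mktuple.
under eq_bigr do rewrite mxE mulr_suml.
rewrite exchange_big; apply: eq_bigr => j _ /=.
by rewrite tnth_mktuple mulr_sumr; apply: eq_bigr => k _; rewrite mulrA.
Qed.

Lemma mx_act1 n (t : n.-tuple R) : mx_act 1%:M t = t.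
Proof.
apply: eq_from_tnth => i; rewrite tnth_mktuple (bigD1 i) //= mxE eqxx mul1r.
rewrite big1 ?addr0 // => j ji; rewrite mxE eq_sym (negbTE ji) mul0r //.
Qed.

Lemma scales_comp d (T : measurableType d) (mu : set T -> \bar R) f g c e :
  measurable_fun setT f ->
  scales_by mu f c -> scales_by mu g e -> scales_by mu (f \o g) (e * c).
Proof.
move=> mf sf sg A mA; rewrite comp_preimage sg; last first.
  by rewrite -[X in measurable X]setTI; exact: mf.
by rewrite sf // muleA EFinM.
Qed.

Section product_scaling.
Local Open Scope ereal_scope.
Context d1 d2 (T1 : measurableType d1) (T2 : measurableType d2).
Variables (m1 : {sigma_finite_measure set T1 -> \bar R})
          (m2 : {sigma_finite_measure set T2 -> \bar R}).

Lemma prod_scales2 (G : T1 -> T2 -> T2) (c : R) : (0 <= c)%R ->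
  (forall x, scales_by m2 (G x) c) ->
  scales_by (m1 \x m2) (fun p => (p.1, G p.1 p.2)) c.
Proof.
move=> c0 sG A mA; rewrite /product_measure1.
rewrite -ge0_integralZl //; last exact: measurable_fun_xsection.
apply: eq_integral => x _ /=; rewrite -(sG x); last exact: measurable_xsection.
by congr (m2 _); apply/seteqP; split => y /=; rewrite /xsection /= !inE.
Qed.

Lemma prod_scales1 (H : T2 -> T1 -> T1) (c : R) : (0 <= c)%R ->
  measurable_fun setT (fun p : T1 * T2 => (H p.2 p.1, p.2)) ->
  (forall y, scales_by m1 (H y) c) ->
  scales_by (m1 \x m2) (fun p => (H p.2 p.1, p.2)) c.
Proof.
move=> c0 mH sH A mA.
have E X : measurable X -> (m1 \x m2) X = (m1 \x^ m2) X.
  move=> mX; apply: (product_measure_unique (m' := (m1 \x^ m2))) => // B C mB mC.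
  exact: product_measure2E.
rewrite !E //; last by rewrite -[X in measurable X]setTI; exact: mH.
rewrite /product_measure2.
rewrite -ge0_integralZl //; last exact: measurable_fun_ysection.
apply: eq_integral => x _ /=; rewrite -(sH x); last exact: measurable_ysection.
by congr (m1 _); apply/seteqP; split => y /=; rewrite /ysection /= !inE.
Qed.

End product_scaling.

Definition box n (a b : R) : set (n.-tuple R) :=
  [set t | forall i, a <= tnth t i <= b].
Arguments box : clear implicits.

Lemma measurable_box n a b : measurable (box n a b).
Proof.
rewrite (_ : box n a b = \bigcap_(i in [set: 'I_n])
    ((fun t : n.-tuple R => tnth t i) @^-1` `[a, b])); last first.
  apply/seteqP; split => t /= H; first by move=> i _ /=; rewrite in_itv /=; exact: H.
  by move=> i; have := H i Logic.I; rewrite /= in_itv.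
apply: fin_bigcap_measurable => // i _.
by rewrite -[X in measurable X]setTI; apply: measurable_tnth'.
Qed.

Definition lebesgue_like n (mu : set (n.-tuple R) -> \bar R) : Prop :=
  [/\ forall a b, a <= b -> mu (box n a b) = ((b - a) ^+ n)%:E,
      forall v, scales_by mu (shift_tuple v) 1
    & forall Q : 'M[R]_n, Q \in unitmx ->
        exists2 c : R, 0 <= c & scales_by mu (mx_act Q) c].

Lemma measurable_shift n (v : n.-tuple R) : measurable_fun setT (shift_tuple v).
Proof.
apply/measurable_fun_tnthP => i.
rewrite (_ : _ \o _ = fun t : n.-tuple R => tnth t i + tnth v i).
  by apply: measurable_funD => //; exact: measurable_tnth'.
by apply/funext => t /=; rewrite tnth_mktuple.
Qed.

Lemma lebesgue_like0 : exists mu : {sigma_finite_measure set (0.-tuple R) -> \bar R},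
  lebesgue_like mu.
Proof.
have [mu muE] : exists m' : {sigma_finite_measure set (0.-tuple R) -> \bar R},
    forall A, m' A = dirac ([tuple] : 0.-tuple R) A.
  apply: sigma_finite_pack.
  apply: fin_num_fun_sigma_finite; first by rewrite measure0.
  by move=> U mU /=; rewrite diracE.
have idE (f : 0.-tuple R -> 0.-tuple R) : scales_by mu f 1.
  by move=> A mA; rewrite mul1e; congr (mu _); apply/seteqP; split => t /=;
    rewrite (tuple0 t) (tuple0 (f _)).
exists mu; split=> [a b ab|v|Q _]; [|exact: idE|by exists 1].
rewrite [LHS]muE diracE expr0 mem_set //; by case.
Qed.

Lemma lebesgue_likeS n (mu : {sigma_finite_measure set (n.-tuple R) -> \bar R}) :
  lebesgue_like mu ->
  exists mu' : {sigma_finite_measure set (n.+1.-tuple R) -> \bar R},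
    lebesgue_like mu'.
Proof.
move=> [mu_box mu_shift mu_lin].
have [leb [leb_itv leb_aff]] := lebesgue_line.
pose T := (R * n.-tuple R)%type.
pose consf (p : T) : n.+1.-tuple R := [tuple of p.1 :: p.2].
have mconsf : measurable_fun setT consf by apply: measurable_cons.
pose prod : {measure set T -> \bar R} := (leb \x mu)%E.
have [m0 m0E] := pushforward_measure prod mconsf.
have consfP t : consf (thead t, [tuple of behead t]) = t.
  by rewrite /consf /= -tuple_eta.
have box_prod a b : consf @^-1` box n.+1 a b = `[a, b]%classic `*` box n a b.
  apply/seteqP; split => -[x t] /=.
    move=> H; split => [|i] /=; first by have := H ord0; rewrite tnth0 in_itv.
    by have := H (lift ord0 i); rewrite tnthS.
  rewrite in_itv /= => -[Hx Ht] i; case: (unliftP ord0 i) => [j|] ->.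
    by rewrite tnthS; exact: Ht.
  by rewrite tnth0.
have m0_box a b : a <= b -> m0 (box n.+1 a b) = ((b - a) ^+ n.+1)%:E.
  move=> ab; rewrite m0E box_prod /prod [LHS]product_measure1E //; last first.
    exact: measurable_box.
  by rewrite [X in (X * _)%E]leb_itv // [X in (_ * X)%E]mu_box // -EFinM exprS.
have sm0 : sigma_finite setT m0.
  exists (fun k => box n.+1 (- k%:R) k%:R).
    apply/seteqP; split => t //= _.
    exists (\max_(i < n.+1) Num.truncn `|tnth t i|).+1 => //= i.
    rewrite -ler_norml; apply: le_trans (_ : (Num.truncn `|tnth t i|).+1%:R <= _).
      by rewrite ltW // truncnS_gt.
    by rewrite ler_nat ltnS; exact: (leq_bigmax i).
  move=> k; split; first exact: measurable_box.
  by rewrite m0_box ?ltey // lerNl; exact: le_trans (ler0n _ _).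
have [m mE] := sigma_finite_pack sm0.
have transfer (F : T -> T) f c : (forall p, f (consf p) = consf (F p)) ->
    scales_by prod F c -> scales_by m f c.
  move=> fF sF A mA; rewrite !mE !m0E -sF.
    by congr (prod _); apply/seteqP; split => p /=; rewrite fF.
  by rewrite -[X in measurable X]setTI; exact: mconsf.
exists m.
(* the map (x, t) |-> (x', S t + x' l + v) with x' = a x + u t + b *)
have block (a b : R) (u : 'I_n -> R) (S : 'M[R]_n) (l v : n.-tuple R) (c : R) :
    a != 0 -> 0 <= c -> scales_by mu (mx_act S) c ->
    scales_by prod ((fun p : T => (p.1, shift_tuple [tuple p.1 * tnth l i + tnth v i | i < n] (mx_act S p.2)))
       \o (fun p : T => (a * p.1 + (\sum_(j < n) u j * tnth p.2 j + b), p.2)))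
      (c * `|a|^-1).
  move=> a0 c0 sS.
  have mu1 : measurable_fun setT (fun p : T => p.2) by exact: measurable_snd.
  have mu0 : measurable_fun setT (fun p : T => p.1) by exact: measurable_fst.
  have m2 : measurable_fun setT (fun p : T => (a * p.1 + (\sum_(j < n) u j * tnth p.2 j + b), p.2)).
    apply: measurable_fun_pair => //=.
    apply: measurable_funD; first exact: measurable_funM.
    apply: measurable_funD => //.
    exact: (measurableT_comp (measurable_lin u) mu1).
  have mo : measurable_fun setT (fun p : T => (p.1,
      shift_tuple [tuple p.1 * tnth l i + tnth v i | i < n] (mx_act S p.2))).
    apply: measurable_fun_pair => //=; apply/measurable_fun_tnthP => i.
    rewrite (_ : _ \o _ = fun p : T =>
        \sum_(j < n) S i j * tnth p.2 j + (p.1 * tnth l i + tnth v i)).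
      apply: measurable_funD; first exact: (measurableT_comp (measurable_lin _) mu1).
      by apply: measurable_funD => //; exact: measurable_funM.
    by apply/funext => p /=; rewrite !tnth_mktuple.
  rewrite mulrC; apply: scales_comp => //.
    apply: (@prod_scales2 _ _ _ _ leb mu (fun x t => shift_tuple
      [tuple x * tnth l i + tnth v i | i < n] (mx_act S t)) c) => // x.
    rewrite -[c]mulr1; apply: scales_comp => //; exact: measurable_shift.
  apply: (@prod_scales1 _ _ _ _ leb mu
    (fun t x => a * x + (\sum_(j < n) u j * tnth t j + b)) `|a|^-1) => // y.
  exact: leb_aff.
(* the corresponding statement on (n+1)-tuples, in coordinates *)
have block' (f : n.+1.-tuple R -> n.+1.-tuple R) (a b : R) (u : 'I_n -> R) (S : 'M[R]_n) (l v : n.-tuple R) (c : R) :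
    a != 0 -> 0 <= c -> scales_by mu (mx_act S) c ->
    (forall t, tnth (f t) ord0 =
       a * tnth t ord0 + (\sum_(j < n) u j * tnth t (lift ord0 j) + b)) ->
    (forall t i, tnth (f t) (lift ord0 i) =
       \sum_(j < n) S i j * tnth t (lift ord0 j) +
       (tnth (f t) ord0 * tnth l i + tnth v i)) ->
    scales_by m f (c * `|a|^-1).
  move=> a0 c0 sS f0 fS; apply: (transfer _ _ _ _ (block a b u S l v c a0 c0 sS)) => -[x t].
  have tE j : tnth (consf (x, t)) (lift ord0 j) = tnth t j by rewrite tnthS.
  have f0E : tnth (f (consf (x, t))) ord0 =
      a * x + (\sum_(j < n) u j * tnth t j + b).
    by rewrite f0; congr (_ + (_ + _)); apply: eq_bigr => j _; rewrite tE.
  apply: eq_from_tnth => i; case: (unliftP ord0 i) => [j|] -> /=.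
    rewrite tnthS fS f0E !tnth_mktuple /=; congr (_ + _).
    by apply: eq_bigr => k _; rewrite tE.
  by rewrite f0E tnth0.
have zero_tuple i : tnth [tuple (0 : R) | _ < n] i = 0 by rewrite tnth_mktuple.
have one_lin : scales_by mu (mx_act 1%:M) 1.
  by move=> A mA; rewrite mul1e; congr (mu _); apply/seteqP; split => t /=; rewrite mx_act1.
have sum1 i (t : n.+1.-tuple R) :
    \sum_(j < n) (1%:M : 'M[R]_n) i j * tnth t (lift ord0 j) = tnth t (lift ord0 i).
  rewrite (bigD1 i) //= mxE eqxx mul1r big1 ?addr0 // => j ji.
  by rewrite mxE eq_sym (negbTE ji) mul0r.
split => [a b ab|v|Q Qu].
- by rewrite [LHS]mE m0_box.
- suff: scales_by m (shift_tuple v) (1 * `|1|^-1) by rewrite normr1 divr1.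
  apply: (block' _ 1 (tnth v ord0) (fun=> 0) 1%:M [tuple 0 | _ < n]
    [tuple tnth v (lift ord0 i) | i < n]) => // [t|t i].
  + by rewrite tnth_mktuple mul1r big1 ?add0r // => j _; rewrite mul0r.
  + by rewrite sum1 !tnth_mktuple mulr0 add0r.
have pivot (P : 'M[R]_(1 + n)) : P \in unitmx -> P ord0 ord0 != 0 ->
    exists2 c : R, 0 <= c & scales_by m (mx_act P) c.
  move=> Pu a0; set a := P ord0 ord0 in a0.
  pose u := ursubmx P; pose w := dlsubmx P.
  pose S := drsubmx P - a^-1 *: (w *m u).
  have PE : P = block_mx 1%:M 0 (a^-1 *: w) 1%:M *m block_mx a%:M u 0 S.
    rewrite mulmx_block !mul1mx !mul0mx !addr0 -scalemxAl mul_mx_scalar.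
    rewrite scalerA mulVf // scale1r -scalemxAl addrCA subrr addr0.
    rewrite -[LHS]submxK; congr block_mx.
    by rewrite [LHS]mx11_scalar !mxE; congr (_%:M); congr (P _ _); apply: val_inj.
  have Su : S \in unitmx.
    move: Pu; rewrite PE unitmxE det_mulmx det_lblock det_ublock !det1 !mul1r.
    by rewrite unitrM => /andP[_]; rewrite unitmxE.
  have [c c0 sS] := mu_lin _ Su.
  exists (c * `|a|^-1); first by rewrite mulr_ge0.
  have uE j : u ord0 j = P ord0 (lift ord0 j).
    by rewrite !mxE; congr (P _ _); apply: val_inj.
  have wE i : w i ord0 = P (lift ord0 i) ord0.
    by rewrite !mxE; congr (P _ _); apply: val_inj.
  have f0 t : tnth (mx_act P t) ord0 =
      a * tnth t ord0 + \sum_(j < n) u ord0 j * tnth t (lift ord0 j).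
    by rewrite tnth_mktuple big_ord_recl; congr (_ + _); apply: eq_bigr => j _; rewrite uE.
  apply: (block' _ a 0 (u ord0) S [tuple w i ord0 / a | i < n] [tuple 0 | _ < n]) => // t.
    by rewrite addr0 f0.
  move=> i; rewrite f0 zero_tuple addr0 tnth_mktuple big_ord_recl -wE.
  rewrite tnth_mktuple mulrDl mulrA [a * _]mulrC -mulrA -[_ * (w i _ / a)]mulrA.
  rewrite [a * _]mulrC divfK // addrCA [w i _ * _]mulrC; congr (_ + _).
  rewrite mulr_suml -big_split /=; apply: eq_bigr => j _.
  have SE : S i j = P (lift ord0 i) (lift ord0 j) - a^-1 * (w i ord0 * u ord0 j).
    rewrite /S [LHS]mxE; congr (_ + _).
      by rewrite !mxE; congr (P _ _); apply: val_inj.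
    rewrite mxE; congr (- _); rewrite mxE; congr (_ * _).
    by rewrite mxE big_ord1.
  by rewrite SE; ring.
have [Q0|Q0] := eqVneq (Q ord0 ord0) 0; last exact: pivot.
have [k Qk] : exists k : 'I_n, Q (lift ord0 k) ord0 != 0.
  apply/existsP; apply: contraT => /existsPn H; move: Qu; rewrite unitmxE.
  rewrite (expand_det_col _ ord0) big1 ?unitr0 // => i _.
  case: (unliftP ord0 i) => [j|] ->; last by rewrite Q0 mul0r.
  by have := H j; rewrite negbK => /eqP ->; rewrite mul0r.
pose E (s : R) : 'M[R]_n.+1 := 1%:M + s *: delta_mx ord0 (lift ord0 k).
have EE s t : E s *m E t = E (s + t).
  rewrite /E mulmxDl mul1mx mulmxDr mulmx1 -scalemxAl -scalemxAr.
  by rewrite mul_delta_mx_cond /= mulr0n !scaler0 addr0 -addrA -scalerDl addrC [t + s]addrC addrC.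
have E0 : E 0 = 1%:M by rewrite /E scale0r addr0.
have Eu s : E s \in unitmx.
  by have := @mulmx1_unit _ _ (E s) (E (- s)); rewrite EE subrr E0 => /(_ erefl)[].
have [||c c0 sc] := pivot (E 1 *m Q).
- by rewrite unitmx_mul Eu.
- rewrite mxE (bigD1 (lift ord0 k)) //= big1 ?addr0; last first.
    move=> j jk; rewrite !mxE eqxx (negbTE jk) mulr0 addr0.
    by have [<-|] := eqVneq ord0 j; rewrite ?Q0 ?mulr0 ?mul0r.
  by rewrite !mxE !eqxx mulr1 add0r mul1r.
exists (c * (1 * `|1|^-1)); first by rewrite normr1 divr1 mulr1.
rewrite (_ : mx_act Q = mx_act (E (-1)) \o mx_act (E 1 *m Q)); last first.
  by apply/funext => t /=; rewrite -mx_actM mulmxA EE addNr E0 mul1mx.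
apply: scales_comp => //; first exact: measurable_mx_act.
have dE s i j : E s i j = (i == j)%:R + s * ((i == ord0) && (j == lift ord0 k))%:R.
  by rewrite !mxE.
apply: (block' _ 1 0 (fun j => E (-1) ord0 (lift ord0 j)) 1%:M [tuple 0 | _ < n]
    [tuple 0 | _ < n]) => // [t|t i].
- by rewrite tnth_mktuple big_ord_recl addr0 dE eqxx /= mulr0 addr0.
- rewrite sum1 !zero_tuple mulr0 !addr0 tnth_mktuple (bigD1 (lift ord0 i)) //=.
  rewrite dE eqxx /= mulr0 addr0 mul1r big1 ?addr0 // => j ji.
  by rewrite dE eq_sym (negbTE ji) /= mulr0 addr0 mul0r.
Qed.

Lemma lebesgue_like_exists n :
  exists mu : {sigma_finite_measure set (n.-tuple R) -> \bar R}, lebesgue_like mu.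
Proof.
elim: n => [|n [mu]]; [exact: lebesgue_like0|exact: lebesgue_likeS].
Qed.

Lemma sum_sqr_mx_act n (Q : 'M[R]_n) (t : n.-tuple R) : Q^T *m Q = 1%:M ->
  \sum_(i < n) tnth (mx_act Q t) i ^+ 2 = \sum_(i < n) tnth t i ^+ 2.
Proof.
move=> QQ; pose v : 'cV[R]_n := \col_i tnth t i.
have sq (s : n.-tuple R) (w : 'cV[R]_n) : w = \col_i tnth s i ->
    \sum_(i < n) tnth s i ^+ 2 = (w^T *m w) ord0 ord0.
  by move=> ->; rewrite mxE; apply: eq_bigr => i _; rewrite !mxE expr2.
rewrite (sq t v) // (sq (mx_act Q t) (Q *m v)).
  by rewrite trmx_mul mulmxA -[v^T *m _ *m _]mulmxA QQ mulmx1.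
apply/colP => i; rewrite !mxE tnth_mktuple.
by apply: eq_bigr => j _; rewrite !mxE.
Qed.

Lemma rotation_invariant_exists n : (0 < n)%N ->
  exists mu : probability (n.-tuple R) R, rotation_invariant_on_sphere mu.
Proof.
move=> n0; have [mu [mu_box _ mu_lin]] := lebesgue_like_exists n.
pose N (t : n.-tuple R) := \sum_(i < n) tnth t i ^+ 2.
have mN : measurable_fun setT N.
  by apply: measurable_sum => i; apply: measurable_funX; exact: measurable_tnth'.
pose D : set (n.-tuple R) := N @^-1` `]0, 1].
have mD : measurable D by rewrite -[X in measurable X]setTI; exact: mN.
pose nrm (t : n.-tuple R) : n.-tuple R := [tuple tnth t i * (N t) `^ (- 2^-1) | i < n].
have mnrm : measurable_fun setT nrm.
  apply/measurable_fun_tnthP => i.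
  rewrite (_ : _ \o _ = fun t : n.-tuple R => tnth t i * (N t) `^ (- 2^-1)).
    apply: measurable_funM; first exact: measurable_tnth'.
    exact: (measurableT_comp (measurable_powR _)).
  by apply/funext => t /=; rewrite tnth_mktuple.
have [pm pmE] := pushforward_measure (mrestr mu mD) mnrm.
have {}pmE A : pm A = mu (nrm @^-1` A `&` D) by rewrite pmE.
have n0' : 0 < n%:R :> R by rewrite ltr0n.
have Dpos : (0 < mu D)%E.
  have le1 : (2 * n%:R)^-1 <= n%:R^-1 :> R by rewrite lef_pV2 ?posrE; lra.
  apply: lt_le_trans (_ : mu (box n (2 * n%:R)^-1 n%:R^-1) <= _)%E.
    rewrite mu_box // lte_fin exprn_gt0 // subr_gt0 ltf_pV2 ?posrE; lra.
  apply: le_measure; rewrite ?inE //; first exact: measurable_box.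
  move=> t tb; rewrite /D /= in_itv /=; apply/andP; split.
    rewrite /N (bigD1 (Ordinal n0)) //= ltr_wpDr //.
      by apply: sumr_ge0 => i _; exact: sqr_ge0.
    rewrite exprn_gt0 //; have /andP[+ _] := tb (Ordinal n0).
    by apply: lt_le_trans; rewrite invr_gt0; lra.
  have H (i : 'I_n) : true -> tnth t i ^+ 2 <= n%:R^-1.
    move=> _; have /andP[t1 t2] := tb i.
    have t0 : 0 <= tnth t i by apply: le_trans t1; rewrite invr_ge0; lra.
    have : tnth t i * tnth t i <= n%:R^-1 * 1.
      apply: ler_pM => //; apply: le_trans t2 _; rewrite invf_le1 //.
      by rewrite ler1n.
    by rewrite mulr1 expr2.
  apply: le_trans (ler_sum _ H) _.
  by rewrite sumr_const card_ord -[_ *+ n]mulr_natr mulVf // gt_eqF.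
have Dfin : (mu D < +oo)%E.
  apply: le_lt_trans (_ : mu (box n (- 1) 1) < _)%E; last first.
    by rewrite mu_box ?ltey //; lra.
  apply: le_measure; rewrite ?inE //; first exact: measurable_box.
  move=> t; rewrite /D /= in_itv /= => /andP[_ N1] i.
  rewrite -ler_norml -(@expr_le1 _ 2) // real_normK ?num_real //.
  apply: le_trans N1; rewrite /N (bigD1 i) //= lerDl.
  by apply: sumr_ge0 => j _; exact: sqr_ge0.
have pmT : pm setT = mu D by rewrite pmE preimage_setT setTI.
pose P : probability (n.-tuple R) R := mnormalize pm point.
exists P.
have muN A : P A = (pm A * (fine (mu D))^-1%:E)%E.
  by rewrite /P /= /mnormalize pmT gt_eqF //= lt_eqF.
split.
  rewrite muN (_ : pm _ = mu D).
    by rewrite -{1}(@fineK _ (mu D)) ?ge0_fin_numE // -EFinM divff // fine_eq0 ?gt_eqF // ge0_fin_numE.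
  rewrite pmE; congr (mu _); apply/seteqP; split => t /=; first by case.
  move=> Dt; split => //; rewrite /sphere /=.
  have Nt : 0 < N t by move: Dt; rewrite /D /= in_itv /= => /andP[].
  under eq_bigr do rewrite tnth_mktuple exprMn.
  rewrite -mulr_suml -/(N t) -powR_mulrn ?powR_ge0 // -powRrM.
  rewrite (_ : - 2^-1 * 2%:R = -1); last by field.
  by rewrite powR_inv1 ?ltW // divff // gt_eqF.
move=> Q QQ A mA; rewrite !muN; congr (_ * _)%E.
have Qu : Q \in unitmx by have [] := mulmx1_unit QQ.
have [c c0 sc] := mu_lin _ Qu.
have NQ t : N (mx_act Q t) = N t by exact: sum_sqr_mx_act.
have c1 : c = 1.
  have : mu (mx_act Q @^-1` D) = mu D.
    by congr (mu _); apply/seteqP; split => t; rewrite /D /= NQ.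
  rewrite sc // -(@fineK _ (mu D)) ?ge0_fin_numE // -EFinM => -[] /eqP.
  rewrite -subr_eq0 -{2}[fine _]mul1r -mulrBl mulf_eq0 subr_eq0.
  rewrite fine_eq0 ?ge0_fin_numE //.
  by rewrite [X in _ || X]gt_eqF // orbF => /eqP.
have mnA : measurable (nrm @^-1` A `&` D).
  by apply: measurableI => //; rewrite -[X in measurable X]setTI; exact: mnrm.
rewrite !pmE -[RHS]mul1e -c1 -sc //; congr (mu _).
have nQ t : nrm (mx_act Q t) = mx_act Q (nrm t).
  apply: eq_from_tnth => i; rewrite !tnth_mktuple NQ mulr_suml.
  by apply: eq_bigr => j _; rewrite tnth_mktuple mulrA.
by apply/seteqP; split => t /=; rewrite nQ /D /= NQ.
Qed.

End sphere_existence.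

(* The default value [point] only matters for n = 0, see [sphere_measureP]. *)
Definition sphere_measure (R : realType) (n : nat) : probability (n.-tuple R) R :=
  xget point [set mu | rotation_invariant_on_sphere mu].

Lemma sphere_measureP (R : realType) (n : nat) : (0 < n)%N ->
  rotation_invariant_on_sphere (sphere_measure R n).
Proof. by move=> /(@rotation_invariant_exists R) [mu mu_inv]; exact: (xgetI point mu_inv). Qed.

Local Open Scope complex_scope.

Section elementary.
Variable R : realType.

Definition cosh (a : R) : R := (expR a + expR (- a)) / 2.
Definition sinh (a : R) : R := (expR a - expR (- a)) / 2.
Definition tanh (a : R) : R := sinh a / cosh a.

(* r ^ s for a real r > 0 and a complex s *)
Definition cpow (r : R) (s : R[i]) : R[i] :=
  (expR (complex.Re s * ln r))%:C *
  (cos (complex.Im s * ln r) +i* sin (complex.Im s * ln r)).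

Definition cintegral d (T : measurableType d) (mu : {measure set T -> \bar R})
    (D : set T) (f : T -> R[i]) : R[i] :=
  (\int[mu]_(x in D) complex.Re (f x)) +i* (\int[mu]_(x in D) complex.Im (f x)).

Lemma eq_cintegral d (T : measurableType d) (mu : {measure set T -> \bar R}) D
    (f g : T -> R[i]) :
  {in D, f =1 g} -> cintegral mu D f = cintegral mu D g.
Proof. by move=> fg; congr (_ +i* _); apply: eq_Rintegral => x xD; rewrite fg. Qed.

(* unconditional (equivalently, absolute) convergence: the net of all finite
   partial sums converges to s *)
Definition has_sum (I : choiceType) (u : I -> R[i]) (s : R[i]) : Prop :=
  partial_sum u @ totally --> (s : R[i]^o).

Definition pochhammer (a : R[i]) (n : nat) : R[i] := \prod_(i < n) (a + i%:R).

End elementary.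

Section zonal_spherical_function.
Variables (R : realType) (p q : nat).

(* A vector k of R^(p+q) is split as (k_1, .., k_q; k_(q+1), .., k_(p+q)). *)
Definition qform (k : 'cV[R]_(q + p)) : R :=
  \sum_(i < q) usubmx k i ord0 ^+ 2 - \sum_(j < p) dsubmx k j ord0 ^+ 2.

Definition cone : set 'cV[R]_(q + p) := [set k | qform k = 0 /\ k != 0].

Definition homogeneous (sigma : R[i]) (F : 'cV[R]_(q + p) -> R[i]) : Prop :=
  forall (a : R) k, a != 0 -> cone k -> F (a *: k) = cpow `|a| sigma * F k.

(* the action T^(sigma)(g) F (k) = F (g^-1 k) *)
Definition rep (g : 'M[R]_(q + p)) (F : 'cV[R]_(q + p) -> R[i]) :
    'cV[R]_(q + p) -> R[i] :=
  fun k => F (invmx g *m k).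

(* e and f are the coordinate vectors of k_1 and k_(p+q): in this plane the
   matrix is [cosh, sinh; sinh, cosh], and it is the identity elsewhere. *)
Definition hyperbolic_rotation (alpha : R) : 'M[R]_(q + p) :=
  let e := \col_(i < q + p) (i == 0 :> nat)%:R in
  let f := \col_(i < q + p) (i == (q + p).-1 :> nat)%:R in
  1%:M + (cosh alpha - 1) *: (e *m e^T + f *m f^T)
       + sinh alpha *: (e *m f^T + f *m e^T).

(* The SO(p) x SO(q)-invariant vector 1: the function on the cone homogeneous of
   degree sigma and equal to 1 on S^(q-1) x S^(p-1), see
   [invariant_vector_homogeneous] and [invariant_vector_spheres]. *)
Definition invariant_vector (sigma : R[i]) (k : 'cV[R]_(q + p)) : R[i] :=
  cpow (Num.sqrt (\sum_(i < q) usubmx k i ord0 ^+ 2)) sigma.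

Definition spheres_point (u : q.-tuple R) (v : p.-tuple R) : 'cV[R]_(q + p) :=
  col_mx (\col_i tnth u i) (\col_j tnth v j).

(* the matrix element; [zonal_spherical_explicit] is its integral formula *)
Definition zonal_spherical (sigma : R[i]) (alpha : R) : R[i] :=
  cintegral (sphere_measure R q) (sphere R q) (fun u =>
    cintegral (sphere_measure R p) (sphere R p) (fun v =>
      rep (hyperbolic_rotation alpha) (invariant_vector sigma) (spheres_point u v))).

Lemma spheres_point_cone u v : sphere R q u -> sphere R p v ->
  cone (spheres_point u v).
Proof.
rewrite /sphere /= => Su Sv.
have uE : \sum_(i < q) usubmx (spheres_point u v) i ord0 ^+ 2 = 1.
  by rewrite -[RHS]Su; apply: eq_bigr => i _; rewrite col_mxKu mxE.
split; rewrite /qform.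
  rewrite uE -Sv; apply/eqP; rewrite subr_eq0; apply/eqP.
  by apply: eq_bigr => i _; rewrite col_mxKd mxE.
apply/eqP => k0; move: uE; rewrite k0 big1 => [/eqP|i _].
  by rewrite eq_sym oner_eq0.
by rewrite !mxE expr0n.
Qed.

Lemma cpowM (r s : R) z : 0 < r -> 0 < s -> cpow (r * s) z = cpow r z * cpow s z.
Proof.
move=> r0 s0; rewrite /cpow lnM // !mulrDr expRD cosD sinD.
by apply/eqP; rewrite eq_complex /=; apply/andP; split; apply/eqP; ring.
Qed.

Lemma cpow1 (z : R[i]) : cpow 1 z = 1.
Proof. by rewrite /cpow ln1 !mulr0 expR0 cos0 sin0 mul1r. Qed.

Lemma cpow_sqrt (r : R) z : 0 < r -> cpow (Num.sqrt r) z = cpow r (z / 2).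
Proof.
move=> r0; have lnE : ln (Num.sqrt r) = 2^-1 * ln r.
  have s0 : 0 < Num.sqrt r by rewrite sqrtr_gt0.
  by rewrite -{2}(sqr_sqrtr (ltW r0)) expr2 lnM ?posrE //; field.
case: z => a b; rewrite /cpow lnE.
have -> : (a +i* b) / 2 = (a / 2) +i* (b / 2) :> R[i].
  have -> : (2 : R[i])^-1 = (2^-1)%:C by rewrite fmorphV /= rmorph_nat.
  by apply/eqP; rewrite eq_complex /=; apply/andP; split; apply/eqP; ring.
by rewrite /= !mulrA.
Qed.

Lemma invariant_vector_homogeneous sigma : homogeneous sigma (invariant_vector sigma).
Proof.
move=> a k a0 [k0 kn0]; rewrite /invariant_vector.
have -> : \sum_(i < q) usubmx (a *: k) i ord0 ^+ 2 =
    a ^+ 2 * \sum_(i < q) usubmx k i ord0 ^+ 2.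
  by rewrite mulr_sumr; apply: eq_bigr => i _; rewrite !mxE exprMn.
rewrite sqrtrM ?sqr_ge0 // sqrtr_sqr cpowM ?normr_gt0 //.
have ge n (w : 'cV[R]_n) : 0 <= \sum_(i < n) w i ord0 ^+ 2.
  by apply: sumr_ge0 => i _; exact: sqr_ge0.
rewrite sqrtr_gt0 lt_neqAle ge andbT eq_sym; apply: contra kn0 => /eqP u0.
have z n (w : 'cV[R]_n) : \sum_(i < n) w i ord0 ^+ 2 = 0 -> w = 0.
  move=> /eqP; rewrite psumr_eq0; last by move=> i _; exact: sqr_ge0.
  move=> /allP H; apply/colP => i; rewrite mxE; apply/eqP.
  by rewrite -sqrf_eq0; apply: H; rewrite mem_index_enum.
move: k0; rewrite /qform u0 sub0r => /eqP; rewrite oppr_eq0 => /eqP d0.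
by rewrite -[k]vsubmxK (z _ _ u0) (z _ _ d0) col_mx0.
Qed.

Lemma invariant_vector_spheres sigma u v : sphere R q u ->
  invariant_vector sigma (spheres_point u v) = 1.
Proof.
move=> Su; rewrite /invariant_vector.
rewrite (_ : \sum_(i < q) _ = 1) ?sqrtr1 ?cpow1 //.
by rewrite -[RHS]Su; apply: eq_bigr => i _; rewrite col_mxKu mxE.
Qed.

End zonal_spherical_function.
Arguments zonal_spherical {R} p q sigma alpha.

Section explicit_formula.
Variables (R : realType) (p q : nat).
Local Notation i0 := (lshift p.+1 (ord0 : 'I_q.+1)).
Local Notation iN := (rshift q.+1 (ord_max : 'I_p.+1)).

Lemma cosh2_sinh2 (a : R) : cosh a ^+ 2 - sinh a ^+ 2 = 1.
Proof.
rewrite /cosh /sinh.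
suff : expR a * expR (- a) = 1 by move=> ?; nra.
by rewrite -expRD subrr expR0.
Qed.

Lemma coshN (a : R) : cosh (- a) = cosh a.
Proof. by rewrite /cosh opprK addrC. Qed.

Lemma sinhN (a : R) : sinh (- a) = - sinh a.
Proof. by rewrite /sinh opprK; field. Qed.

Lemma hyperbolic_rotationE alpha (k : 'cV[R]_(q.+1 + p.+1)) i :
  (hyperbolic_rotation p.+1 q.+1 alpha *m k) i ord0 =
    if i == i0 then cosh alpha * k i0 ord0 + sinh alpha * k iN ord0
    else if i == iN then sinh alpha * k i0 ord0 + cosh alpha * k iN ord0
    else k i ord0.
Proof.
rewrite /hyperbolic_rotation.
set e := \col_i _; set f := \col_i _.
have eE : e^T *m k = (k i0 ord0)%:M.
  apply/matrixP => a b; rewrite !ord1 mxE (bigD1 i0) //= big1; last first.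
    move=> j j0; rewrite !mxE (_ : (j == 0 :> nat) = false) ?mul0r //.
    by apply: contraNF j0 => /eqP j0; apply/eqP/val_inj.
  by rewrite !mxE /= mul1r addr0.
have fE : f^T *m k = (k iN ord0)%:M.
  apply/matrixP => a b; rewrite !ord1 mxE (bigD1 iN) //= big1; last first.
    move=> j jN; rewrite !mxE (_ : (j == (q.+1 + p.+1).-1 :> nat) = false) ?mul0r //.
    by apply: contraNF jN => /eqP jN; apply/eqP/val_inj; rewrite /= jN addnS.
  by rewrite !mxE /= addnS eqxx mul1r addr0.
rewrite !mulmxDl mul1mx -!scalemxAl !mulmxDl -!mulmxA eE fE !mul_mx_scalar.
rewrite !mxE.
have -> : (i == 0 :> nat) = (i == i0) by [].
have -> : (i == (q.+1 + p.+1).-1 :> nat) = (i == iN).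
  by rewrite -val_eqE /=; congr (_ == _); rewrite addnS.
have [->|_] := eqVneq i i0.
  by rewrite (_ : (i0 == iN) = false) //=; ring.
by have [->|_] /= := eqVneq i iN; ring.
Qed.

Lemma hyperbolic_rotationK alpha (k : 'cV[R]_(q.+1 + p.+1)) :
  hyperbolic_rotation p.+1 q.+1 alpha *m (hyperbolic_rotation p.+1 q.+1 (- alpha) *m k) = k.
Proof.
have := cosh2_sinh2 alpha => cs.
apply/colP => i; rewrite !hyperbolic_rotationE !eqxx /= coshN sinhN.
have [->|_] := eqVneq i i0.
  by rewrite -[RHS]mul1r -cs; ring.
by have [->|//] := eqVneq i iN; rewrite -[RHS]mul1r -cs; ring.
Qed.

Lemma hyperbolic_rotationV alpha :
  invmx (hyperbolic_rotation p.+1 q.+1 alpha : 'M[R]_(q.+1 + p.+1)) =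
  hyperbolic_rotation p.+1 q.+1 (- alpha).
Proof.
set g := hyperbolic_rotation p.+1 q.+1 alpha.
have gg : g *m hyperbolic_rotation p.+1 q.+1 (- alpha) = 1%:M.
  apply/matrixP => i j.
  have := congr1 (fun v : 'cV[R]_(q.+1 + p.+1) => v i ord0)
    (hyperbolic_rotationK alpha (delta_mx j ord0)).
  by rewrite mulmxA -colE !mxE eqxx andbT.
have [gu _] := mulmx1_unit gg.
by rewrite -[RHS](mulKmx gu) gg mulmx1.
Qed.

Lemma hyperbolic_rotation_u alpha (k : 'cV[R]_(q.+1 + p.+1)) (i : 'I_q) :
  (hyperbolic_rotation p.+1 q.+1 alpha *m k) (lshift p.+1 (lift ord0 i)) ord0 =
  k (lshift p.+1 (lift ord0 i)) ord0.
Proof.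
rewrite hyperbolic_rotationE (_ : (_ == i0) = false) // (_ : (_ == iN) = false) //.
rewrite -val_eqE /= /bump leq0n add1n addSn eqSS ltn_eqF //.
exact: leq_trans (ltn_ord i) (leq_addr _ _).
Qed.

Lemma hyperbolic_rotation_v alpha (k : 'cV[R]_(q.+1 + p.+1)) (j : 'I_p) :
  (hyperbolic_rotation p.+1 q.+1 alpha *m k)
    (rshift q.+1 (widen_ord (leqnSn p) j)) ord0 =
  k (rshift q.+1 (widen_ord (leqnSn p) j)) ord0.
Proof.
rewrite hyperbolic_rotationE (_ : (_ == i0) = false) // (_ : (_ == iN) = false) //.
by rewrite -val_eqE /= eqn_add2l ltn_eqF.
Qed.

Lemma hyperbolic_rotation_qform alpha (k : 'cV[R]_(q.+1 + p.+1)) :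
  qform (hyperbolic_rotation p.+1 q.+1 alpha *m k) = qform k.
Proof.
have qE (w : 'cV[R]_(q.+1 + p.+1)) : qform w =
    w i0 ord0 ^+ 2 + \sum_(i < q) w (lshift p.+1 (lift ord0 i)) ord0 ^+ 2 -
    (\sum_(j < p) w (rshift q.+1 (widen_ord (leqnSn p) j)) ord0 ^+ 2 + w iN ord0 ^+ 2).
  rewrite /qform big_ord_recl big_ord_recr /= !mxE; congr (_ + _ - (_ + _)).
    by apply: eq_bigr => i _; rewrite mxE.
  by apply: eq_bigr => i _; rewrite mxE.
rewrite !qE !hyperbolic_rotationE !eqxx /=.
rewrite (eq_bigr (fun i => k (lshift p.+1 (lift ord0 i)) ord0 ^+ 2)); last first.
  by move=> i _; rewrite hyperbolic_rotation_u.
rewrite [in X in _ - X](eq_bigr (fun j => k (rshift q.+1 (widen_ord (leqnSn p) j)) ord0 ^+ 2)); last first.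
  by move=> j _; rewrite hyperbolic_rotation_v.
have := cosh2_sinh2 alpha => cs; apply/eqP; rewrite -subr_eq0.
rewrite -[q.+1.-1]/q.
set x := k i0 ord0; set y := k iN ord0; set A := \sum_(_ < q) _; set B := \sum_(_ < p) _.
rewrite [X in X == _](_ : _ = (cosh alpha ^+ 2 - sinh alpha ^+ 2 - 1) * (x ^+ 2 - y ^+ 2)).
  by rewrite cs subrr mul0r.
ring.
Qed.

Definition Lambda (alpha x y : R) : R :=
  1 + (x ^+ 2 + y ^+ 2) * sinh alpha ^+ 2 - 2 * x * y * sinh alpha * cosh alpha.

Lemma cosh_gt0 (a : R) : 0 < cosh a.
Proof. by rewrite divr_gt0 // addr_gt0 // expR_gt0. Qed.

Lemma Lambda_gt0 (alpha x y : R) : x ^+ 2 <= 1 -> y ^+ 2 <= 1 -> 0 < Lambda alpha x y.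
Proof.
move=> x1 y1; have cs := cosh2_sinh2 alpha; have c0 := cosh_gt0 alpha.
set c := cosh alpha in cs c0 *; set s := sinh alpha in cs *.
have -> : Lambda alpha x y = 1 - y ^+ 2 + (y * c - x * s) ^+ 2.
  apply/eqP; rewrite -subr_eq0 /Lambda -/c -/s.
  rewrite [X in X == _](_ : _ = y ^+ 2 * (1 - (c ^+ 2 - s ^+ 2))); last by ring.
  by rewrite cs subrr mulr0.
rewrite lt_neqAle addr_ge0 ?sqr_ge0 ?subr_ge0 // andbT eq_sym.
apply/negP; rewrite paddr_eq0 ?sqr_ge0 ?subr_ge0 // => /andP[/eqP y2].
rewrite sqrf_eq0 subr_eq0 => /eqP z.
have : c ^+ 2 = x ^+ 2 * s ^+ 2.
  by rewrite -[RHS]exprMn -z [RHS]exprMn (_ : y ^+ 2 = 1) ?mul1r //; lra.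
have : x ^+ 2 * s ^+ 2 <= s ^+ 2 by rewrite ler_piMl ?sqr_ge0.
lra.
Qed.

Lemma zonal_spherical_explicit sigma alpha :
  zonal_spherical p.+1 q.+1 sigma alpha =
  cintegral (sphere_measure R q.+1) (sphere R q.+1) (fun u =>
    cintegral (sphere_measure R p.+1) (sphere R p.+1) (fun v =>
      cpow (Lambda alpha (tnth v ord_max) (tnth u ord0)) (sigma / 2))).
Proof.
apply: eq_cintegral => u; rewrite inE => Su; apply: eq_cintegral => v; rewrite inE => Sv.
rewrite /rep hyperbolic_rotationV /invariant_vector.
have le1 n (t : n.-tuple R) i : sphere R n t -> tnth t i ^+ 2 <= 1.
  move=> <-; rewrite (bigD1 i) //= lerDl.
  by apply: sumr_ge0 => j _; exact: sqr_ge0.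
have L0 := Lambda_gt0 alpha (le1 _ v ord_max Sv) (le1 _ u ord0 Su).
transitivity (cpow (Num.sqrt (Lambda alpha (tnth v ord_max) (tnth u ord0))) sigma); last first.
  by apply: cpow_sqrt.
apply: (congr1 (fun r => cpow (Num.sqrt r) sigma)).
move: Su; rewrite /sphere /= big_ord_recl => Su.
rewrite big_ord_recl mxE hyperbolic_rotationE eqxx coshN sinhN.
rewrite (eq_bigr (fun i => tnth u (lift ord0 i) ^+ 2)); last first.
  by move=> i _; rewrite mxE hyperbolic_rotation_u col_mxEu mxE.
rewrite col_mxEu col_mxEd !mxE /Lambda.
have -> : \sum_(i < q) tnth u (lift ord0 i) ^+ 2 = 1 - tnth u ord0 ^+ 2.
  by rewrite -Su addrC addKr.
have cs := cosh2_sinh2 alpha.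
have -> : 1 + (tnth v ord_max ^+ 2 + tnth u ord0 ^+ 2) * sinh alpha ^+ 2 -
   2 * tnth v ord_max * tnth u ord0 * sinh alpha * cosh alpha =
   (cosh alpha * tnth u ord0 - sinh alpha * tnth v ord_max) ^+ 2 +
   (1 - (cosh alpha ^+ 2 - sinh alpha ^+ 2) * tnth u ord0 ^+ 2) by ring.
by rewrite cs mul1r mulNr.
Qed.

Lemma zonal_spherical0 (sigma : R[i]) : zonal_spherical p.+1 q.+1 sigma 0 = 1.
Proof.
have cint1 n (f : n.+1.-tuple R -> R[i]) : {in sphere R n.+1, f =1 fun=> 1} ->
    cintegral (sphere_measure R n.+1) (sphere R n.+1) f = 1.
  move=> f1; rewrite (eq_cintegral _ f1) /cintegral /Rintegral.
  have mS : measurable (sphere R n.+1).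
    rewrite -[X in measurable X]setTI (_ : sphere R n.+1 =
      (fun t : n.+1.-tuple R => \sum_(i < n.+1) tnth t i ^+ 2) @^-1` [set 1]) //.
    have mN : measurable_fun setT (fun t : n.+1.-tuple R => \sum_(i < n.+1) tnth t i ^+ 2).
      by apply: measurable_sum => i; apply: measurable_funX; exact: measurable_tnth'.
    by apply: mN => //; exact: measurable_set1.
  rewrite !integral_cst //= !(sphere_measureP R (ltn0Sn n)).1 !mule1 //=.
rewrite zonal_spherical_explicit; apply: (cint1) => u _; apply: (cint1) => v _.
have -> : Lambda 0 (tnth v ord_max) (tnth u ord0) = 1.
  by rewrite /Lambda /sinh oppr0 subrr mul0r expr0n /= !(mulr0, mul0r) subr0 addr0.
by rewrite cpow1.
Qed.

End explicit_formula.

(* Main.v *)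
(* With a = - sigma / 2, t = tanh alpha and c = cosh alpha one has
     Lambda = c^2 ((1 - t x y)^2 - t^2 (1 - x^2) (1 - y^2)),
   so the expansion of c^(2a) Lambda^(-a) by the binomial series, first in
   h = t^2 (1 - x^2) (1 - y^2) / (1 - t x y)^2 and then in t x y, converges
   uniformly on the square. Integrating termwise needs only the moments
   E[x^(2j) (1 - x^2)^k] of a coordinate on the sphere; rotation invariance gives
   them through E[(u_1 + tau u_2)^(2n+2)] = (1 + tau^2)^(n+1) E[u_1^(2n+2)].
   This yields a double series for c^(2a) Z that is symmetric in p and q.
   Vandermonde's identity regroups it by powers of t^2, and multiplication by
   (1 - t^2)^(a - 1/2), that is, Euler's transformation of 2F1 (Saalschutz's
   identity on coefficients), turns it into the Horn series of c Z. Symmetry in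
   p and q gives the second formula. *)
Require Import Defs.
From mathcomp Require Import all_boot all_order all_algebra finmap.
From mathcomp Require Import all_classical all_reals all_analysis.
From mathcomp Require Import measurable_realfun complex zify ring lra.
From mathcomp.analysis.showcase Require Import summability.

Set Implicit Arguments.
Unset Strict Implicit.
Unset Printing Implicit Defensive.

Import Order.TTheory GRing.Theory Num.Theory.
Import numFieldNormedType.Exports.
Import ComplexField.Normc.

Local Open Scope ring_scope.
Local Open Scope complex_scope.

(** * Identities for Pochhammer symbols *)

(** Rotation invariance replaces densities on the spheres, so that the two-point sphere S^0 and the
    circle need no separate treatment: the moment formula holds for every d > 0. Under the integral
    sign only uniform approximation by finite sums of products f(u) g(v) is used; it also yields the
    measurability of the kernel and of its inner integral. As both arguments of the Horn series are
    equal, its value depends only on its diagonal sums m + n = N. Vandermonde and Saalschutz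
    therefore enter only as finite identities between coefficients, while convergence is settled
    separately by geometric majorants. The exponent a - 1/2 has two roles: it is C - A - B in
    Euler's transformation and does not depend on m, so that one factor serves all m; and since 1 -
    t^2 = c^(-2), it turns c^(2a) Z into c Z. *)

Section pochhammer_identities.
Variable R : realType.
Implicit Types (a b c u v : R[i]) (m n k j N : nat).

Lemma pochhammer0 a : pochhammer a 0 = 1.
Proof. by rewrite /pochhammer big_ord0. Qed.

Lemma pochhammerS a n : pochhammer a n.+1 = pochhammer a n * (a + n%:R).
Proof. by rewrite /pochhammer big_ord_recr. Qed.

Lemma pochhammerD a m n :
  pochhammer a (m + n) = pochhammer a m * pochhammer (a + m%:R) n.
Proof.
elim: n => [|n IHn]; first by rewrite addn0 pochhammer0 mulr1.
by rewrite addnS !pochhammerS IHn natrD -!mulrA addrA.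
Qed.

Lemma pochhammerSl a n : pochhammer a n.+1 = a * pochhammer (a + 1) n.
Proof. by rewrite -add1n pochhammerD pochhammerS pochhammer0 mul1r addr0. Qed.

Lemma pochhammer1 n : pochhammer (1 : R[i]) n = n`!%:R.
Proof.
elim: n => [|n IHn]; first by rewrite pochhammer0.
by rewrite pochhammerS IHn factS mulrC natrM nat1r.
Qed.

(** The factors are read backwards and negated: [a + i] is [- (1 - a - n + (n - 1 - i))]. *)
Lemma pochhammer_rev a n :
  pochhammer a n = (-1) ^+ n * pochhammer (1 - a - n%:R) n.
Proof.
elim: n a => [|n IHn] a; first by rewrite !pochhammer0 mulr1.
rewrite pochhammerSl IHn pochhammerS exprS.
rewrite (_ : 1 - (a + 1) - n%:R = 1 - a - n.+1%:R); last by rewrite -natr1; ring.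
by rewrite -natr1; ring.
Qed.

Lemma pochhammer_neq0 a n : (forall i, a + i%:R != 0) -> pochhammer a n != 0.
Proof. by move=> a0; apply/prodf_neq0 => i _. Qed.

Lemma natr_half_neq0 (d m : nat) : (0 < d)%N -> (d%:R / 2 + m%:R : R[i]) != 0.
Proof.
move=> d0; rewrite (_ : _ + _ = (d + m * 2)%N%:R / 2); last first.
  by rewrite natrD natrM; field.
by rewrite mulf_neq0 ?invr_eq0 ?pnatr_eq0 // addn_eq0 negb_and -lt0n d0.
Qed.

Lemma half_pochhammer_neq0 (d n : nat) :
  (0 < d)%N -> pochhammer (d%:R / 2 : R[i]) n != 0.
Proof. by move=> d0; apply: pochhammer_neq0 => i; exact: natr_half_neq0. Qed.

Lemma fact_neq0 n : n`!%:R != 0 :> R[i].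
Proof. by rewrite pnatr_eq0 -lt0n fact_gt0. Qed.

Lemma bin_fact_div n k : (k <= n)%N ->
  'C(n, k)%:R = n`!%:R / (k`!%:R * (n - k)`!%:R) :> R[i].
Proof.
by move=> kn; rewrite -(bin_fact kn) !natrM mulfK // mulf_neq0 ?fact_neq0.
Qed.

Lemma binS_shift n l : ('C(n, l)%:R * (n%:R - l%:R) : R[i]) = 'C(n, l.+1)%:R * l.+1%:R.
Proof.
have [ln|nl] := leqP l n; last by rewrite !bin_small ?mul0r // ltnW.
by rewrite -natrB // -!natrM mulnC -mul_bin_left mulnC.
Qed.

(** Scheme of the inductions below: the term of row n at index l splits into [f l], which stays at l
    in row n + 1, and [g l], which moves to l + 1; [h] collects both arrivals. The boundary value
    [f n.+1] carries a zero binomial. *)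
Lemma sum_bin_step n (f g h : nat -> R[i]) : h 0 = f 0 ->
  (forall l, (l <= n)%N ->
     'C(n.+1, l.+1)%:R * h l.+1 = 'C(n, l.+1)%:R * f l.+1 + 'C(n, l)%:R * g l) ->
  \sum_(l < n.+2) 'C(n.+1, l)%:R * h l = \sum_(l < n.+1) 'C(n, l)%:R * (f l + g l).
Proof.
move=> h0 hS; rewrite big_ord_recl [in LHS](eq_bigr (fun l : 'I_n.+1 =>
   'C(n, l.+1)%:R * f l.+1 + 'C(n, l)%:R * g l)) => [|l _]; last first.
  by rewrite /= hS // -ltnS.
rewrite big_split /= addrA [in RHS](eq_bigr (fun l : 'I_n.+1 =>
   'C(n, l)%:R * f l + 'C(n, l)%:R * g l)) => [|l _]; last by rewrite mulrDr.
rewrite big_split /=; congr (_ + _).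
rewrite [in RHS]big_ord_recl big_ord_recr /= (bin_small (ltnSn n)) mul0r addr0.
by rewrite !bin0 h0.
Qed.

Lemma sum_pascal n (f : nat -> R[i]) :
  \sum_(l < n.+2) 'C(n.+1, l)%:R * f l =
  \sum_(l < n.+1) 'C(n, l)%:R * (f l + f l.+1).
Proof. by apply: (sum_bin_step (f := f) (g := fun l => f l.+1)) => // l _; rewrite binS natrD mulrDl. Qed.

(** The new factor splits as [u + v + n = (v + n - l) + (u + l)]; one summand extends the product of
    [v], the other that of [u]. *)
Lemma pochhammer_vandermonde u v n :
  \sum_(j < n.+1) 'C(n, j)%:R * (pochhammer u j * pochhammer v (n - j)) =
  pochhammer (u + v) n.
Proof.
elim: n => [|n IHn]; first by rewrite big_ord1 bin0 !pochhammer0 !mulr1.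
rewrite pochhammerS -IHn mulr_suml.
rewrite (@sum_bin_step _
   (fun l => pochhammer u l * pochhammer v (n - l) * (v + n%:R - l%:R))
   (fun l => pochhammer u l * pochhammer v (n - l) * (u + l%:R))
   (fun l => pochhammer u l * pochhammer v (n.+1 - l))).
- by apply: eq_bigr => l _; ring.
- by rewrite !subn0 pochhammerS; ring.
move=> l ln; rewrite subSS binS natrD mulrDl; congr (_ + _); last first.
  by rewrite pochhammerS; ring.
move: ln; rewrite leq_eqVlt => /predU1P[->|ln]; first by rewrite (bin_small (ltnSn n)) !mul0r.
congr (_ * _); rewrite -(subnSK ln) [pochhammer v _.+1]pochhammerS (natrB _ ln); ring.
Qed.

(* The induction step is termwise: with [e = c - a - b],
   [(c - a + n) (c - b + n) = (c + n + l) (e + n - l) + (a + l) (b + l)]. *)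
Lemma pochhammer_saalschutz c a b n :
  \sum_(l < n.+1) 'C(n, l)%:R * (pochhammer (c - a - b) (n - l) *
     pochhammer a l * pochhammer b l * pochhammer (c + l%:R) (n - l)) =
  pochhammer (c - a) n * pochhammer (c - b) n.
Proof.
elim: n => [|n IHn]; first by rewrite big_ord1 bin0 !pochhammer0 !mulr1.
rewrite !pochhammerS mulrACA -IHn mulr_suml.
set t := fun l => pochhammer (c - a - b) (n - l) *
     pochhammer a l * pochhammer b l * pochhammer (c + l%:R) (n - l).
rewrite (@sum_bin_step _
   (fun l => t l * ((c + n%:R + l%:R) * (c - a - b + n%:R - l%:R)))
   (fun l => t l * ((a + l%:R) * (b + l%:R)))
   (fun l => pochhammer (c - a - b) (n.+1 - l) * pochhammer a l * pochhammer b l *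
      pochhammer (c + l%:R) (n.+1 - l))).
- by apply: eq_bigr => l _; rewrite /t; ring.
- by rewrite /t !subn0 !pochhammerS; ring.
move=> l ln; rewrite subSS /t !pochhammerS.
have E : pochhammer (c + l%:R) (n - l) * (c + n%:R) =
    (c + l%:R) * pochhammer (c + l.+1%:R) (n - l).
  have -> : c + l.+1%:R = c + l%:R + 1 by rewrite -natr1 addrA.
  by rewrite -pochhammerSl pochhammerS (natrB _ ln); congr (_ * _); ring.
(* For l = n the natural number [n - l.+1] is a truncated difference, so this case is treated
   apart. *)
move: ln; rewrite leq_eqVlt => /predU1P[l_n|ln].
  by rewrite l_n subnn (bin_small (ltnSn n)) !binn !pochhammer0; ring.
rewrite -(subnSK ln) !pochhammerS.
have sE : ((n - l.+1)%:R : R[i]) = n%:R - l.+1%:R by rewrite natrB.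
have E' : pochhammer (c + l%:R) (n - l.+1).+1 =
    (c + l%:R) * pochhammer (c + l.+1%:R) (n - l.+1).
  by rewrite pochhammerSl -natr1 addrA.
rewrite pochhammerS in E'.
rewrite binS natrD.
have bE := binS_shift n l.
set X := pochhammer (c + l.+1%:R) (n - l.+1) in E' *.
set Y := pochhammer (c + l%:R) (n - l.+1) in E' *.
set B1 := ('C(n, l.+1)%:R : R[i]) in bE *; set B0 := ('C(n, l)%:R : R[i]) in bE *.
rewrite !sE in E' *.
set P := pochhammer (c - a - b) (n - l.+1).
have -> : B0 * (P * (c - a - b + (n%:R - l.+1%:R)) * pochhammer a l * pochhammer b l *
   (Y * (c + l%:R + (n%:R - l.+1%:R))) * ((a + l%:R) * (b + l%:R))) =
   (P * (c - a - b + (n%:R - l.+1%:R)) * pochhammer a l * pochhammer b l *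
    ((a + l%:R) * (b + l%:R))) * X * (B0 * (c + l%:R)).
  transitivity ((P * (c - a - b + (n%:R - l.+1%:R)) * pochhammer a l * pochhammer b l *
    ((a + l%:R) * (b + l%:R))) * B0 * (Y * (c + l%:R + (n%:R - l.+1%:R)))); first by ring.
  by rewrite E'; ring.
(* [c + l] and [c + n] differ by [n - l], and [binS_shift] converts this factor of C(n, l) into a
   multiple of C(n, l + 1); what remains is a polynomial identity. *)
have -> : B0 * (c + l%:R) = B0 * (c + n%:R) - B1 * l.+1%:R by rewrite -bE; ring.
by rewrite -natr1; ring.
Qed.

End pochhammer_identities.

(** * Moment functionals and coefficients of the double series *)

Section sphere_moment_identities.
Variable R : realType.
Implicit Types (a b c u v : R[i]) (d p q m n k j N : nat).

(** Both sides run over the triples with sum N, grouped by the first index or by the sum of the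
    first two. Three arguments in [h] let the induction shift the first one alone. *)
Lemma triangle_exchange (V : zmodType) N (h : nat -> nat -> nat -> V) :
  \sum_(i < N.+1) \sum_(l < (N - i).+1) h i l (N - i - l)%N =
  \sum_(m < N.+1) \sum_(i < m.+1) h i (m - i)%N (N - m)%N.
Proof.
elim: N h => [|N IHN] h.
  by rewrite !big_ord1 /= ?big_ord1.
rewrite big_ord_recl /= subn0 [in RHS]big_ord_recl /= big_ord1 subn0 subnn.
rewrite (eq_bigr (fun i : 'I_N.+1 => \sum_(l < (N - i).+1) h i.+1 l (N - i - l)%N)) //.
rewrite (IHN (fun i l r => h i.+1 l r)) [in LHS]big_ord_recl /= subn0 -addrA -big_split /=.
congr (_ + _); apply: eq_bigr => m _.
rewrite [in RHS]big_ord_recl /=; congr (_ + _).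
Qed.

(** The factors at positions 2n and 2n + 1 are [2 * (u + n)] and [2 * (u + 1 / 2 + n)]. *)
Lemma pochhammer_double u n :
  pochhammer (2 * u) (2 * n) = 4 ^+ n * (pochhammer u n * pochhammer (u + 1 / 2) n).
Proof.
elim: n => [|n IHn]; first by rewrite muln0 !pochhammer0 !mulr1.
rewrite (_ : (2 * n.+1 = (2 * n).+2)%N); last by rewrite mulnS.
by rewrite !pochhammerS IHn -natr1 natrM exprS; field.
Qed.

Lemma fact_double n :
  (2 * n)`!%:R = 4 ^+ n * (pochhammer (1 / 2) n * n`!%:R) :> R[i].
Proof.
transitivity (pochhammer (2 * (1 / 2) : R[i]) (2 * n)).
  by rewrite -pochhammer1; congr (pochhammer _ _); field.
rewrite pochhammer_double -pochhammer1; congr (_ * (_ * pochhammer _ _)).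
by field.
Qed.

(** The moment E[x^(2j) (1 - x^2)^k] of a coordinate x on S^(d-1), whose square has the Beta(1/2,
    (d-1)/2) law. For d = 1 it is 0 as soon as k > 0, in accordance with x^2 = 1 on S^0. *)
Definition sphere_moment d j k : R[i] :=
  pochhammer (1 / 2) j * pochhammer ((d%:R - 1) / 2) k / pochhammer (d%:R / 2) (j + k).

(** Counterpart of (1 - x^2)^(k+1) = (1 - x^2)^k - x^2 (1 - x^2)^k; it amounts to [(d - 1) / 2 + k =
    (d / 2 + j + k) - (1 / 2 + j)]. *)
Lemma sphere_momentS d j k : (0 < d)%N ->
  sphere_moment d j k.+1 = sphere_moment d j k - sphere_moment d j.+1 k.
Proof.
move=> d0; rewrite /sphere_moment addnS addSn !pochhammerS.
have := half_pochhammer_neq0 R (j + k) d0; set P := pochhammer _ (j + k) => P0.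
have := @natr_half_neq0 R _ (j + k) d0; rewrite natrD => Q0.
field; rewrite P0 andbT; apply: contraNN Q0 => /eqP E.
rewrite (_ : _ + _ = (d%:R + (j%:R + k%:R) * 2) / 2); last by field.
by rewrite E mul0r.
Qed.

Lemma sphere_moment_expand d j k : (0 < d)%N ->
  sphere_moment d j k =
  \sum_(i < k.+1) 'C(k, i)%:R * ((-1) ^+ i * sphere_moment d (j + i) 0).
Proof.
move=> d0; elim: k j => [|k IHk] j.
  by rewrite big_ord1 bin0 !mul1r addn0.
rewrite sphere_momentS // !IHk
  (sum_pascal k (fun i => (-1) ^+ i * sphere_moment d (j + i) 0)) -sumrB.
by apply: eq_bigr => i _; rewrite addSnnS exprS; ring.
Qed.

(* Integral over the two spheres of the general term of the double binomial
   expansion of [cpow (Lambda / cosh ^+ 2) (- a)], without the power of [tanh];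
   the odd powers in the second expansion integrate to 0. *)
Definition zonal_coef a p q k j : R[i] :=
  pochhammer a k / k`!%:R * (pochhammer (2 * a + (2 * k)%:R) (2 * j) / (2 * j)`!%:R) *
  (sphere_moment p j k * sphere_moment q j k).

Lemma half_pochhammer1_neq0 n : pochhammer (1 / 2 : R[i]) n != 0.
Proof. exact: (half_pochhammer_neq0 R n (ltnSn 0)). Qed.

(** The duplication formula applies both to the symbol of length 2j and to (2j)!, and the two powers
    of 4 cancel. *)
Lemma zonal_coefE a p q k j : zonal_coef a p q k j =
  pochhammer a (k + j) * pochhammer (a + k%:R + 1 / 2) j /
  (k`!%:R * j`!%:R * pochhammer (1 / 2) j) * (sphere_moment p j k * sphere_moment q j k).
Proof.
rewrite /zonal_coef; congr (_ * _); rewrite pochhammerD fact_double natrM -mulrDr pochhammer_double.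
have h0 := half_pochhammer1_neq0 j.
have k0 := fact_neq0 R k; have j0 := fact_neq0 R j.
have f0 : 4 ^+ j != 0 :> R[i] by rewrite expf_neq0 // pnatr_eq0.
by field; rewrite h0 k0 j0 f0.
Qed.

Lemma zonal_coefC a p q k j : zonal_coef a p q k j = zonal_coef a q p k j.
Proof. by rewrite /zonal_coef [sphere_moment p _ _ * _]mulrC. Qed.

(** For fixed m, the series in l is a multiple of 2F1(a + m, (q - 1)/2; q/2 + m), the side of
    Euler's transformation opposite to the Horn series. *)
Definition euler_coef a p q m l : R[i] :=
  pochhammer a (m + l) * pochhammer (1 + a - q%:R / 2) m * pochhammer (1 / 2) m *
  pochhammer ((q%:R - 1) / 2) l /
  (pochhammer (q%:R / 2) (m + l) * pochhammer (p%:R / 2) m * m`!%:R * l`!%:R).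

(* Expand [(1 - x^2)^k] under the first moment functional, collect [x^(2m)] and
   sum over j by Vandermonde. *)
Lemma sum_zonal_coef a p q N : (0 < p)%N -> (0 < q)%N ->
  \sum_(j < N.+1) zonal_coef a p q (N - j) j =
  \sum_(m < N.+1) euler_coef a p q m (N - m).
Proof.
move=> p0 q0; pose b : R[i] := (q%:R - 1) / 2.
(* Here k = N - j is split as i + r, where i counts the factors - x^2 taken from (1 - x^2)^k. *)
pose h j i r : R[i] := pochhammer a (i + r + j) * pochhammer (a + (i + r)%:R + 1 / 2) j *
  pochhammer b (i + r) / (j`!%:R * pochhammer (q%:R / 2) (j + (i + r))) *
  ((-1) ^+ i / (i`!%:R * r`!%:R)) * sphere_moment p (j + i) 0.
transitivity (\sum_(j < N.+1) \sum_(i < (N - j).+1) h j i (N - j - i)%N).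
  apply: eq_bigr => j _; rewrite zonal_coefE (sphere_moment_expand _ _ p0).
  rewrite mulr_suml mulr_sumr; apply: eq_bigr => i _.
  have ij : (i <= N - j)%N by rewrite -ltnS.
  rewrite /h subnKC // bin_fact_div // /sphere_moment -/b.
  have h0 := half_pochhammer1_neq0 j.
  have ? := fact_neq0 R (N - j); have ? := fact_neq0 R j; have ? := fact_neq0 R i.
  have ? := fact_neq0 R (N - j - i).
  have ? := half_pochhammer_neq0 R (j + (N - j)) q0.
  have ? := half_pochhammer_neq0 R (j + i + 0) p0.
  by field; do !(apply/andP; split).
rewrite triangle_exchange; apply: eq_bigr => m _; have mN : (m <= N)%N by rewrite -ltnS.
have ? := fact_neq0 R m; have ? := fact_neq0 R (N - m).
have ? := half_pochhammer_neq0 R N q0; have ? := half_pochhammer_neq0 R m p0.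
(* The two parameters add up to q/2 - a - m, the reflection of 1 + a - q/2. The first comes from
   reflecting (a + N - j + 1/2)_j, the second from splitting ((q - 1)/2)_(N - j) after N - m
   factors. *)
have E : pochhammer (1 + a - q%:R / 2) m = (-1) ^+ m * \sum_(j < m.+1) 'C(m, j)%:R *
    (pochhammer (1 / 2 - a - N%:R) j * pochhammer (b + (N - m)%:R) (m - j)).
  rewrite pochhammer_vandermonde pochhammer_rev natrB //; congr (_ * pochhammer _ _).
  by rewrite /b; field.
rewrite /euler_coef subnKC // E mulr_sumr mulr_sumr !mulr_suml.
apply: eq_bigr => j _; have jm : (j <= m)%N by rewrite -ltnS.
have jN := leq_trans jm mN.
rewrite /h [(j + (m - j))%N]subnKC // (_ : (m - j + (N - m) = N - j)%N); last first.
  by rewrite addnC addnBA // subnK.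
rewrite subnK // [(j + (N - j))%N]subnKC // bin_fact_div //.
have -> : pochhammer b (N - j) = pochhammer b (N - m) * pochhammer (b + (N - m)%:R) (m - j).
  by rewrite -pochhammerD addnBA // subnK.
have -> : pochhammer (a + (N - j)%:R + 1 / 2) j = (-1) ^+ j * pochhammer (1 / 2 - a - N%:R) j.
  rewrite pochhammer_rev natrB ?(leq_trans jm) //; congr (_ * pochhammer _ _).
  by field.
rewrite /sphere_moment addn0 pochhammer0.
have ? := fact_neq0 R j; have ? := fact_neq0 R (m - j).
have -> : (-1) ^+ m = (-1) ^+ j * (-1) ^+ (m - j) :> R[i] by rewrite -exprD subnKC.
rewrite -/b.
by field; do !(apply/andP; split).
Qed.

Definition horn_coef a p q m n : R[i] :=
  pochhammer a m * pochhammer (1 + a - q%:R / 2) m * pochhammer (q%:R / 2 - a) n *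
  pochhammer (1 / 2) (m + n) /
  (pochhammer (q%:R / 2) (m + n) * pochhammer (p%:R / 2) m * m`!%:R * n`!%:R).

(* Euler's transformation [2F1(A, B; C; z) = (1 - z)^(C - A - B) 2F1(C - A, C - B; C; z)]
   in the variable n, with A = q/2 - a, B = 1/2 + m, C = q/2 + m. *)
Lemma horn_coefE a p q m n : (0 < p)%N -> (0 < q)%N ->
  horn_coef a p q m n = \sum_(l < n.+1) euler_coef a p q m l *
    (pochhammer (1 / 2 - a) (n - l) / (n - l)`!%:R).
Proof.
move=> p0 q0; have := pochhammer_saalschutz (q%:R / 2 + m%:R) (a + m%:R) ((q%:R - 1) / 2) n.
rewrite (_ : q%:R / 2 + m%:R - (a + m%:R) = q%:R / 2 - a); last by ring.
rewrite (_ : q%:R / 2 + m%:R - _ = 1 / 2 + m%:R); last by field.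
rewrite (_ : q%:R / 2 - a - _ = 1 / 2 - a); last by field.
rewrite /horn_coef => E; have -> : pochhammer (1 / 2) (m + n) =
    pochhammer (1 / 2) m * pochhammer (1 / 2 + m%:R) n :> R[i] by rewrite pochhammerD.
transitivity (pochhammer a m * pochhammer (1 + a - q%:R / 2) m * pochhammer (1 / 2) m *
  (pochhammer (q%:R / 2 - a) n * pochhammer (1 / 2 + m%:R) n) /
  (pochhammer (q%:R / 2) (m + n) * pochhammer (p%:R / 2) m * m`!%:R * n`!%:R)).
  by congr (_ / _); ring.
rewrite -E mulr_sumr mulr_suml; apply: eq_bigr => l _.
have ln : (l <= n)%N by rewrite -ltnS.
rewrite /euler_coef [pochhammer a (m + l)]pochhammerD bin_fact_div //.
have -> : pochhammer (q%:R / 2) (m + n) = pochhammer (q%:R / 2) (m + l) *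
    pochhammer (q%:R / 2 + m%:R + l%:R) (n - l) :> R[i].
  by rewrite -addrA -natrD -pochhammerD -addnA subnKC.
have ? : pochhammer (q%:R / 2 + m%:R + l%:R) (n - l) != 0 :> R[i].
  by apply: pochhammer_neq0 => i; rewrite -!addrA -!natrD natr_half_neq0.
have ? := half_pochhammer_neq0 R (m + l) q0; have ? := half_pochhammer_neq0 R m p0.
have ? := fact_neq0 R m; have ? := fact_neq0 R n; have ? := fact_neq0 R l.
have ? := fact_neq0 R (n - l).
by field; do !(apply/andP; split).
Qed.

(** These are the diagonal sums of the Cauchy product of the series of [zonal_coef], grouped by
    powers of T, with the binomial series of (1 - T)^(a - 1/2). *)
Lemma sum_horn_coef a p q N : (0 < p)%N -> (0 < q)%N ->
  \sum_(m < N.+1) horn_coef a p q m (N - m) =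
  \sum_(L < N.+1) (\sum_(j < L.+1) zonal_coef a p q (L - j) j) *
    (pochhammer (1 / 2 - a) (N - L) / (N - L)`!%:R).
Proof.
move=> p0 q0; under eq_bigr do rewrite horn_coefE //.
rewrite (triangle_exchange N (fun m l r => euler_coef a p q m l *
    (pochhammer (1 / 2 - a) r / r`!%:R))).
by apply: eq_bigr => L _; rewrite sum_zonal_coef // mulr_suml.
Qed.

End sphere_moment_identities.

(** * Unconditional double series *)

Section double_series.
Variable R : realType.
Implicit Types (u : nat -> nat -> R[i]) (S : R[i]).

Lemma normc_ge0 (z : R[i]) : 0 <= normc z.
Proof. by case: z => a b; rewrite sqrtr_ge0. Qed.

Lemma normcR (r : R) : normc r%:C = `|r|.
Proof. by rewrite /normc /= expr0n addr0 sqrtr_sqr. Qed.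

Lemma normc_natr n : normc (n%:R : R[i]) = n%:R.
Proof. by rewrite -[n%:R]/((1 : R[i]) *+ n) (normcMn (1 : Rcomplex R)) normc1. Qed.

Lemma normc_distC (z w : R[i]) : normc (z - w) = normc (w - z).
Proof. by rewrite -(normcN (z - w : Rcomplex R)) opprB. Qed.

Lemma normc_triangle (w z v : R[i]) : normc (z - v) <= normc (z - w) + normc (w - v).
Proof. by rewrite -(subrKA w); exact: le_normcD. Qed.

Lemma normc_sum I (r : seq I) (P : pred I) (F : I -> R[i]) :
  normc (\sum_(i <- r | P i) F i) <= \sum_(i <- r | P i) normc (F i).
Proof.
elim/big_rec2 : _ => [|i x y _ H]; first by rewrite normc0.
by apply: le_trans (le_normcD _ _) _; rewrite lerD2l.
Qed.

Definition partial_sum2 u n (P : nat -> nat -> bool) :=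
  \sum_(i < n) \sum_(j < n | P i j) u i j.

(* Unconditional convergence over [nat * nat], phrased with the sub-families
   [P] of large squares that contain a fixed square. *)
Definition sums_to u S := forall e : R, 0 < e -> exists n0, forall n (P : nat -> nat -> bool), (n0 <= n)%N ->
  (forall i j, (i < n0)%N -> (j < n0)%N -> P i j) -> normc (partial_sum2 u n P - S) <= e.

Definition abs_summable u := exists M : R, forall n,
  \sum_(i < n) \sum_(j < n) normc (u i j) <= M.

Lemma sum2_widen (V : nmodType) (f : nat -> nat -> V) a b n : (a <= n)%N -> (b <= n)%N ->
  \sum_(i < a) \sum_(j < b) f i j =
  \sum_(i < n) \sum_(j < n | (i < a)%N && (j < b)%N) f i j.
Proof.
move=> an bn; rewrite (big_ord_widen n (fun i => \sum_(j < b) f i j)) // big_mkcond /=.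
apply: eq_bigr => i _; case: ifPn => ia; last by rewrite big_pred0.
exact: (big_ord_widen n (fun j => f i j)).
Qed.

(** Indices inside the small square cancel, because [P] contains them; every other index contributes
    at most its norm. *)
Lemma partial_sum2_box u n0 n (P : nat -> nat -> bool) : (n0 <= n)%N ->
  (forall i j, (i < n0)%N -> (j < n0)%N -> P i j) ->
  normc (partial_sum2 u n P - \sum_(i < n0) \sum_(j < n0) u i j) <=
  \sum_(i < n) \sum_(j < n) normc (u i j) - \sum_(i < n0) \sum_(j < n0) normc (u i j).
Proof.
move=> n0n HP; rewrite (sum2_widen u n0n n0n) (sum2_widen (fun i j => normc (u i j)) n0n n0n).
rewrite -!sumrB; apply: le_trans (normc_sum _ _ _) _; apply: ler_sum => i _.
rewrite [X in normc (X - _)]big_mkcond [X in normc (_ - X)]big_mkcond.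
rewrite [X in _ <= _ - X]big_mkcond -!sumrB /=.
apply: le_trans (normc_sum _ _ _) _; apply: ler_sum => j _.
case: (boolP ((i < n0)%N && (j < n0)%N)) => [/andP[ii jj]|_]; first by rewrite HP // !subrr normc0.
by rewrite !subr0; case: ifP => _; rewrite ?normc0 ?normc_ge0.
Qed.

Lemma abs_summable_tail u (e : R) : abs_summable u -> 0 < e ->
  exists n0, forall m n, (n0 <= m)%N -> (m <= n)%N ->
  \sum_(i < n) \sum_(j < n) normc (u i j) - \sum_(i < m) \sum_(j < m) normc (u i j) <= e.
Proof.
move=> [M HM] e0; pose s n := \sum_(i < n) \sum_(j < n) normc (u i j).
have sm m n : (m <= n)%N -> s m <= s n.
  move=> mn; rewrite /s (sum2_widen (fun i j => normc (u i j)) mn mn).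
  apply: ler_sum => i _; rewrite big_mkcond; apply: ler_sum => j _.
  by case: ifP => // _; exact: normc_ge0.
have hs : has_sup (range s).
  by split; [exists (s 0%N), 0%N|exists M => _ [n _ <-]; exact: HM].
have [_ [n0 _ <-] Hn0] := sup_adherent e0 hs.
exists n0 => m n n0m mn.
have : s n <= sup (range s) by apply: sup_upper_bound => //; exists n.
have := sm _ _ n0m; rewrite -/(s n) -/(s m); lra.
Qed.

(** Beyond a suitable square any two partial sums differ by at most two tails, so one good
    approximation per square identifies the limit: two tails and the given error, [e / 3] each. *)
Lemma sums_to_exhaust u S : abs_summable u ->
  (forall (e : R) n0, 0 < e -> exists n (P : nat -> nat -> bool), [/\ (n0 <= n)%N,
    forall i j, (i < n0)%N -> (j < n0)%N -> P i j & normc (partial_sum2 u n P - S) <= e]) ->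
  sums_to u S.
Proof.
move=> su H e e0; have e3 : 0 < e / 3 by lra.
have [n0 Hn0] := abs_summable_tail su e3.
have [n1 [P1 [n01 HP1 HS]]] := H _ n0 e3.
exists n0 => n P n0n HP; set b := \sum_(i < n0) \sum_(j < n0) u i j.
have B k (Q : nat -> nat -> bool) : (n0 <= k)%N -> (forall i j, (i < n0)%N -> (j < n0)%N -> Q i j) ->
    normc (partial_sum2 u k Q - b) <= e / 3.
  by move=> k0 HQ; apply: le_trans (partial_sum2_box u k0 HQ) _; exact: Hn0.
have := B _ _ n0n HP; have := B _ _ n01 HP1.
have := normc_triangle b (partial_sum2 u n P) S.
have := normc_triangle (partial_sum2 u n1 P1) b S.
rewrite [normc (b - partial_sum2 _ _ _)]normc_distC; lra.
Qed.

Lemma sums_to_rect u S : abs_summable u ->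
  (forall (e : R) n0, 0 < e -> exists K L, [/\ (n0 <= K)%N, (n0 <= L)%N &
    normc (\sum_(i < K) \sum_(j < L) u i j - S) <= e]) -> sums_to u S.
Proof.
move=> su H; apply: sums_to_exhaust => // e n0 e0.
have [K [L [n0K n0L HS]]] := H e n0 e0.
exists (maxn K L), (fun i j => (i < K)%N && (j < L)%N); split.
- exact: leq_trans n0K (leq_maxl _ _).
- by move=> i j /leq_trans -> // /leq_trans ->.
- by rewrite /partial_sum2 -sum2_widen // ?leq_maxl ?leq_maxr.
Qed.

Lemma sum_triangle (V : zmodType) (u : nat -> nat -> V) n :
  \sum_(N < n) \sum_(i < N.+1) u i (N - i)%N = \sum_(i < n) \sum_(j < n | (i + j < n)%N) u i j.
Proof.
case: n => [|n]; first by rewrite !big_ord0.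
rewrite -(triangle_exchange n (fun i l _ => u i l)); apply: eq_bigr => i _.
rewrite (big_ord_widen n.+1 (fun l => u i l)) ?ltnS ?leq_subr //.
by apply: eq_bigl => j; rewrite !ltnS leq_subRL // -ltnS.
Qed.

Lemma sums_to_triangle u S : sums_to u S -> forall e : R, 0 < e ->
  exists n0, forall n, (n0 <= n)%N ->
    normc (\sum_(N < n) \sum_(i < N.+1) u i (N - i)%N - S) <= e.
Proof.
(* Two indices below [n0] have a sum below [n0 + n0], so the triangle contains the square. *)
move=> H e e0; have [n0 Hn0] := H e e0; exists (n0 + n0)%N => n nn.
rewrite (sum_triangle u); apply: (Hn0 _ (fun i j => (i + j < n)%N)); first exact: leq_trans (leq_addl _ _) nn.
move=> i j ii jj; apply: leq_trans nn; rewrite -addSn; apply: leq_add => //.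
exact: ltnW.
Qed.

Lemma triangle_sums_to u S : abs_summable u ->
  (forall e : R, 0 < e -> exists n0, forall n, (n0 <= n)%N ->
    normc (\sum_(N < n) \sum_(i < N.+1) u i (N - i)%N - S) <= e) -> sums_to u S.
Proof.
move=> su H; apply: sums_to_exhaust => // e n0 e0; have [n1 Hn1] := H e e0.
exists (maxn n1 (n0 + n0)), (fun i j => (i + j < maxn n1 (n0 + n0))%N); split.
- by rewrite (leq_trans (leq_addl n0 n0)) // leq_maxr.
- move=> i j ii jj; apply: leq_trans (leq_maxr _ _); rewrite -addSn; apply: leq_add => //.
  exact: ltnW.
- by rewrite /partial_sum2 -(sum_triangle u) Hn1 // leq_maxl.
Qed.

Lemma sums_to_has_sum u S : sums_to u S -> has_sum (fun mn : nat * nat => u mn.1 mn.2) S.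
Proof.
move=> H; apply/(@cvgrPdist_le _ (R[i]^o) _ _ (@filter_filter _ _ totally_filter)) => /= e e0.
(* Positivity in the order of [R[i]] forces [e] to be real. *)
have eE : e = (complex.Re e)%:C.
  by apply/esym/RRe_real; exact: gtr0_real.
have r0 : 0 < complex.Re e by rewrite -ltcR -eE.
have [n0 Hn0] := H _ r0.
exists [fset p | p in allpairs pair (iota 0 n0) (iota 0 n0)]%fset => // J /= sJ.
(* All pairs in [J] have both coordinates below n, so [J] is the sub-family of the n-square cut out
   by membership in [J]. *)
pose n := (n0 + \max_(p <- J) (maxn p.1 p.2).+1)%N.
have HJ p : p \in J -> (maxn p.1 p.2 < n)%N.
  move=> pJ; apply: leq_trans (leq_addl _ _).
  exact: (@leq_bigmax_seq _ _ xpredT (fun p : nat * nat => (maxn p.1 p.2).+1)).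
have := Hn0 n (fun i j => (i, j) \in J) (leq_addr _ _).
have -> : partial_sum2 u n (fun i j => (i, j) \in J) =
    partial_sum (fun mn : nat * nat => u mn.1 mn.2) J.
  rewrite /partial_sum /partial_sum2 pair_big_dep /=.
  rewrite -(big_seq_fsetE _ J xpredT (fun mn : nat * nat => u mn.1 mn.2)) /=.
  pose emb (ij : 'I_n * 'I_n) : nat * nat := (ij.1 : nat, ij.2 : nat).
  rewrite -(big_map emb (fun p => p \in J) (fun p => u p.1 p.2)) -big_filter.
  apply: perm_big; apply: uniq_perm.
  - rewrite filter_uniq // map_inj_uniq ?index_enum_uniq //.
    by move=> [i j] [i' j'] [] /val_inj -> /val_inj ->.
  - exact: fset_uniq.
  move=> [i j]; rewrite mem_filter /=.
  case: (boolP ((i, j) \in J)) => //= ijJ.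
  have := HJ _ ijJ; rewrite gtn_max /= => /andP[ii jj].
  apply/mapP; exists (Ordinal ii, Ordinal jj) => //; exact: mem_index_enum.
move=> HH; rewrite eE -[leLHS]/((normc _)%:C) lecR normc_distC; apply: HH => i j ii jj.
apply: (fsubsetP sJ); rewrite !inE; apply/allpairsP; exists (i, j).
by rewrite !mem_iota /= ii jj.
Qed.

End double_series.

(** * Growth of Pochhammer symbols *)

Section growth.
Variable R : realType.
Implicit Types (a b : R[i]) (r theta rho M : R) (u : nat -> nat -> R[i]).

Lemma expr_small theta M (e : R) : 0 <= theta < 1 -> 0 < e ->
  exists n0, forall n, (n0 <= n)%N -> M * theta ^+ n <= e.
Proof.
move=> /andP[t0 t1] e0; have tn : `|theta| < 1 by rewrite ger0_norm.
have /cvgrPdist_le /(_ e e0) [n0 _ H] := cvg_geometric M tn.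
exists n0 => n n0n; have := H n n0n; rewrite sub0r normrN /geometric /=.
exact: le_trans (ler_norm _).
Qed.

Lemma sum_expr_le theta n : 0 <= theta < 1 -> \sum_(i < n) theta ^+ i <= (1 - theta)^-1.
Proof.
move=> /andP[t0 t1]; have t1' : 0 < 1 - theta by lra.
have E : (1 - theta) * \sum_(i < n) theta ^+ i = 1 - theta ^+ n.
  elim: n => [|n IHn]; first by rewrite big_ord0 mulr0 expr0 subrr.
  by rewrite big_ord_recr mulrDr IHn exprS; ring.
by rewrite -(ler_pM2l t1') E mulfV ?lt0r_neq0 // lerBlDr lerDl exprn_ge0.
Qed.

Lemma abs_summable_geometric u M theta : 0 <= theta < 1 ->
  (forall i j, normc (u i j) <= M * theta ^+ (i + j)) -> abs_summable u.
Proof.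
move=> t01 H; have M0 : 0 <= M by have := H 0 0; rewrite mulr1; apply: le_trans (normc_ge0 _).
have /andP[t0 t1] := t01.
exists (M * ((1 - theta)^-1 * (1 - theta)^-1)) => n.
apply: le_trans (_ : \sum_(i < n) \sum_(j < n) M * theta ^+ (i + j) <= _).
  by apply: ler_sum => i _; apply: ler_sum => j _; exact: H.
rewrite (_ : \sum_(i < n) _ = M * ((\sum_(i < n) theta ^+ i) * (\sum_(j < n) theta ^+ j))).
  have S0 : 0 <= \sum_(i < n) theta ^+ i by apply: sumr_ge0 => i _; exact: exprn_ge0.
  by rewrite ler_wpM2l // ler_pM // sum_expr_le.
rewrite mulr_suml mulr_sumr; apply: eq_bigr => i _; rewrite !mulr_sumr.
by apply: eq_bigr => j _; rewrite exprD.
Qed.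

(** Ratio test: the quotient of consecutive terms tends to 1 in norm, hence is eventually at most
    [rho], and [x] does not increase from [i0] on. *)
Lemma pochhammer_growth a (b rho : R) : 0 < b -> 1 < rho ->
  exists2 M : R, 0 <= M & forall n, normc (pochhammer a n / pochhammer b%:C n) <= M * rho ^+ n.
Proof.
move=> b0 rho1; pose x n := normc (pochhammer a n / pochhammer b%:C n) / rho ^+ n.
have x0 n : 0 <= x n by rewrite /x divr_ge0 ?normc_ge0 // exprn_ge0 //; lra.
suff [M HM] : exists M, forall n, x n <= M.
  exists M => [|n]; first exact: le_trans (x0 0) (HM 0).
  by rewrite -ler_pdivrMr ?HM // exprn_gt0 //; lra.
(* From [i0] on, [normc a <= (rho - 1) * n], so that [normc a + n <= rho * n]. *)
pose i0 := (Num.truncn (normc a / (rho - 1))).+1.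
have xS n : (i0 <= n)%N -> x n.+1 <= x n.
  move=> i0n; rewrite /x !pochhammerS exprS.
  have bn : 0 < b + n%:R by rewrite ltr_pwDl.
  have bE : b%:C + n%:R = (b + n%:R)%:C :> R[i] by rewrite rmorphD /= rmorph_nat.
  have r0 : 0 < rho by lra.
  have E : normc (a + n%:R) <= rho * (b + n%:R).
    apply: le_trans (le_normcD _ _) _; rewrite normc_natr.
    have : normc a / (rho - 1) <= n%:R.
      apply: le_trans (ltW (truncnS_gt _)) _; by rewrite ler_nat.
    rewrite ler_pdivrMr; last by lra.
    have : 0 <= rho * b by rewrite mulr_ge0 ?ltW.
    nra.
  have -> : normc (pochhammer a n * (a + n%:R) / (pochhammer b%:C n * (b%:C + n%:R))) =
      normc (pochhammer a n / pochhammer b%:C n) * (normc (a + n%:R) / (b + n%:R)).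
    by rewrite -(gtr0_norm bn) -normcR -normcV -!normcM -bE; congr normc; rewrite invfM mulrACA.
  set y := normc (pochhammer a n / _); set z := normc (a + _) / _.
  have -> : y * z / (rho * rho ^+ n) = y / rho ^+ n * (z / rho).
    by rewrite invfM; ring.
  rewrite ler_piMr ?divr_ge0 ?normc_ge0 ?exprn_ge0 ?(ltW r0) //.
  by rewrite /z -mulrA -invfM ler_pdivrMr ?mul1r 1?mulrC // mulr_gt0.
exists (\sum_(i < i0.+1) x i) => n.
have xle k : (k <= i0)%N -> x k <= \sum_(i < i0.+1) x i.
  move=> ki; rewrite (bigD1 (Ordinal (ki : k < i0.+1)%N)) //= lerDl.
  by apply: sumr_ge0 => *; exact: x0.
have [|/ltnW] := leqP n i0; first exact: xle.
elim: n => [|n IHn]; first by move=> _; exact: xle.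
rewrite leq_eqVlt => /predU1P[<-|i0n]; first exact: xle.
by apply: le_trans (xS _ i0n) (IHn i0n).
Qed.

(** The majorants of the double series contain at most four powers of [rho] per index. Since (1 +
    d)^4 <= 1 + 15 d for 0 <= d <= 1, the choice d = (1 - T)/16 leaves T + (15/16) (1 - T) T < 1. *)
Lemma expr4_lt (T : R) : 0 <= T < 1 -> exists2 rho, 1 < rho & 0 <= rho ^+ 4 * T < 1.
Proof.
move=> /andP[T0 T1]; pose d := (1 - T) / 16.
have d0 : 0 < d by rewrite /d; lra.
have d1 : d <= 1 by rewrite /d; lra.
exists (1 + d); first by lra.
rewrite mulr_ge0 ?exprn_ge0 //=; last by lra.
have H : (1 + d) ^+ 4 <= 1 + 15 * d.
  have -> : (1 + d) ^+ 4 = 1 + 4 * d + 6 * d ^+ 2 + 4 * d ^+ 3 + d ^+ 4 by ring.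
  have H n : d ^+ n.+1 <= d by rewrite exprS ler_piMr ?exprn_ile1 // ltW.
  have := H 1; have := H 2; have := H 3; lra.
apply: le_lt_trans (ler_wpM2r T0 H) _; rewrite /d; nra.
Qed.

Lemma half_natr (d : nat) : d%:R / 2 = (d%:R / 2)%:C :> R[i].
Proof. by rewrite rmorphM /= fmorphV /= !rmorph_nat. Qed.

End growth.

(** * The binomial series with complex exponent *)

Section complex_powers.
Variable R : realType.
Implicit Types (r s z : R) (b d : R[i]).

Lemma normc_cpow r b : normc (cpow r b) = expR (complex.Re b * ln r).
Proof.
rewrite /cpow normcM normcR ger0_norm ?expR_ge0 //=.
by rewrite cos2Dsin2 sqrtr1 mulr1.
Qed.

Lemma cpowD r b d : cpow r (b + d) = cpow r b * cpow r d.
Proof.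
case: b d => b1 b2 [d1 d2]; rewrite /cpow /= !mulrDl expRD cosD sinD.
by apply/eqP; rewrite eq_complex /=; apply/andP; split; apply/eqP; ring.
Qed.

Lemma cpow0 r : cpow r 0 = 1 :> R[i].
Proof. by rewrite /cpow /= !mul0r expR0 cos0 sin0 mul1r. Qed.

Lemma cpow_natN r n : 0 < r -> cpow r (- n%:R) = (r ^- n)%:C :> R[i].
Proof.
move=> r0; have nE : (- n%:R : R[i]) = (- n%:R)%:C by rewrite rmorphN /= rmorph_nat.
rewrite /cpow nE /= mul0r cos0 sin0 -[1 +i* 0]/(1 : R[i]) mulr1.
by rewrite mulNr expRN expRM_natl lnK.
Qed.

Lemma cpow_nat1 r : 0 < r -> cpow r 1 = r%:C :> R[i].
Proof. by move=> r0; rewrite /cpow /= mul0r mul1r cos0 sin0 lnK // -[1 +i* 0]/(1 : R[i]) mulr1. Qed.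

Lemma cpowNK r b : cpow r (- b) * cpow r b = 1.
Proof. by rewrite -cpowD addNr cpow0. Qed.

Lemma normc_cpow_bounded (m M : R) b : 0 < m -> m <= M ->
  exists2 C, 0 < C & forall r, m <= r <= M -> normc (cpow r b) <= C.
Proof.
move=> m0 mM; exists (expR (`|complex.Re b| * (`|ln m| + `|ln M|))); first exact: expR_gt0.
move=> r /andP[mr rM]; rewrite normc_cpow ler_expR.
apply: le_trans (ler_norm _) _; rewrite normrM ler_wpM2l //.
have r0 : 0 < r by apply: lt_le_trans mr.
have M0 : 0 < M by apply: lt_le_trans rM.
have l1 : ln m <= ln r by rewrite ler_ln.
have l2 : ln r <= ln M by rewrite ler_ln.
have := ler_norm (ln M); have := ler_norm (- ln m); rewrite normrN => h1 h2.
have := normr_ge0 (ln M); have := normr_ge0 (ln m).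
by rewrite ler_norml => *; apply/andP; split; lra.
Qed.

(** Componentwise, so that the derivation rules and the mean value theorem for real functions
    apply. *)
Definition is_cderive (f : R -> R[i]) z d :=
  is_derive z 1 (fun x => complex.Re (f x)) (complex.Re d) /\
  is_derive z 1 (fun x => complex.Im (f x)) (complex.Im d).

Lemma is_cderive_eq f z d d' : is_cderive f z d -> d = d' -> is_cderive f z d'.
Proof. by move=> ? <-. Qed.

Lemma is_cderive_cst b z : is_cderive (fun=> b) z 0.
Proof. by split; exact: is_derive_cst. Qed.

Lemma is_cderiveD f g z d e : is_cderive f z d -> is_cderive g z e ->
  is_cderive (fun x => f x + g x) z (d + e).
Proof.
move=> [f1 f2] [g1 g2]; split.
  rewrite (_ : (fun x => _) = (fun x => complex.Re (f x)) + (fun x => complex.Re (g x))).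
    by rewrite raddfD; exact: is_deriveD.
  by apply/funext => x; rewrite raddfD.
rewrite (_ : (fun x => _) = (fun x => complex.Im (f x)) + (fun x => complex.Im (g x))).
  by rewrite raddfD; exact: is_deriveD.
by apply/funext => x; rewrite raddfD.
Qed.

Lemma complexReD (x y : R[i]) : complex.Re (x + y) = complex.Re x + complex.Re y.
Proof. by case: x; case: y. Qed.

Lemma complexImD (x y : R[i]) : complex.Im (x + y) = complex.Im x + complex.Im y.
Proof. by case: x; case: y. Qed.

Lemma complexReN (x : R[i]) : complex.Re (- x) = - complex.Re x.
Proof. by case: x. Qed.

Lemma complexImN (x : R[i]) : complex.Im (- x) = - complex.Im x.
Proof. by case: x. Qed.

Lemma complexReM (x y : R[i]) : complex.Re (x * y) =
  complex.Re x * complex.Re y - complex.Im x * complex.Im y.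
Proof. by case: x; case: y. Qed.

Lemma complexImM (x y : R[i]) : complex.Im (x * y) =
  complex.Re x * complex.Im y + complex.Im x * complex.Re y.
Proof. by case: x; case: y. Qed.

Lemma is_cderiveM f g z d e : is_cderive f z d -> is_cderive g z e ->
  is_cderive (fun x => f x * g x) z (d * g z + f z * e).
Proof.
move=> [f1 f2] [g1 g2]; split.
  rewrite (_ : (fun x => _) =
    ((fun x => complex.Re (f x)) * (fun x => complex.Re (g x))) -
    ((fun x => complex.Im (f x)) * (fun x => complex.Im (g x)))).
    apply: is_derive_eq; rewrite complexReD !complexReM /GRing.scale /=; ring.
  by apply/funext => x; rewrite complexReM.
rewrite (_ : (fun x => _) =
    ((fun x => complex.Re (f x)) * (fun x => complex.Im (g x))) +
    ((fun x => complex.Im (f x)) * (fun x => complex.Re (g x)))).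
  apply: is_derive_eq; rewrite complexImD !complexImM /GRing.scale /=; ring.
by apply/funext => x; rewrite complexImM.
Qed.

Lemma is_cderive_cpow b z : z < 1 ->
  is_cderive (fun x => cpow (1 - x) b) z (- (b * cpow (1 - z) (b - 1))).
Proof.
move=> z1; have r0 : 0 < 1 - z by rewrite subr_gt0.
have dL : is_derive z 1 (fun x => ln (1 - x)) (- (1 - z)^-1).
  have dln := is_derive1_ln r0.
  have d1 : is_derive z 1 (fun x : R => 1 - x) (-1).
    by apply: is_derive_eq (is_deriveB (is_derive_cst (1 : R) z 1) (is_derive_id z 1)) _; rewrite sub0r.
  by have := @is_derive1_comp R (@ln R) (fun x => 1 - x) z _ _ dln d1; rewrite mulrN1.
have dE c : is_derive z 1 (fun x => expR (c * ln (1 - x)))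
    (expR (c * ln (1 - z)) * (c * - (1 - z)^-1)).
  have dc : is_derive z 1 (fun x => c * ln (1 - x)) (c * - (1 - z)^-1).
    by apply: is_derive_eq (is_deriveZ c dL) _.
  exact: (@is_derive1_comp R (@expR R) (fun x => c * ln (1 - x)) z _ _ (is_derive_expR _) dc).
have dcos c : is_derive z 1 (fun x => cos (c * ln (1 - x)))
    (- sin (c * ln (1 - z)) * (c * - (1 - z)^-1)).
  have dc : is_derive z 1 (fun x => c * ln (1 - x)) (c * - (1 - z)^-1).
    by apply: is_derive_eq (is_deriveZ c dL) _.
  exact: (@is_derive1_comp R (@cos R) (fun x => c * ln (1 - x)) z _ _ (is_derive_cos _) dc).
have dsin c : is_derive z 1 (fun x => sin (c * ln (1 - x)))
    (cos (c * ln (1 - z)) * (c * - (1 - z)^-1)).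
  have dc : is_derive z 1 (fun x => c * ln (1 - x)) (c * - (1 - z)^-1).
    by apply: is_derive_eq (is_deriveZ c dL) _.
  exact: (@is_derive1_comp R (@sin R) (fun x => c * ln (1 - x)) z _ _ (is_derive_sin _) dc).
have cE : cpow (1 - z) (b - 1) = cpow (1 - z) b * ((1 - z)^-1)%:C.
  by rewrite cpowD (cpow_natN 1 r0) expr1.
have ReE x : complex.Re (cpow x b) =
    expR (complex.Re b * ln x) * cos (complex.Im b * ln x).
  by rewrite /cpow complexReM /= mul0r subr0.
have ImE x : complex.Im (cpow x b) =
    expR (complex.Re b * ln x) * sin (complex.Im b * ln x).
  by rewrite /cpow complexImM /= mul0r addr0.
rewrite cE; split.
  rewrite (_ : (fun x => complex.Re _) = (fun x => expR (complex.Re b * ln (1 - x)) *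
      cos (complex.Im b * ln (1 - x)))); last by apply/funext => x; rewrite ReE.
  apply: is_derive_eq (is_deriveM (dE _) (dcos _)) _.
  move: (cpow _ b) (ReE (1 - z)) (ImE (1 - z)) => w wR wI.
  rewrite complexReN mulrA !complexReM !complexImM wR wI /= /GRing.scale /=; ring.
rewrite (_ : (fun x => complex.Im _) = (fun x => expR (complex.Re b * ln (1 - x)) *
      sin (complex.Im b * ln (1 - x)))); last by apply/funext => x; rewrite ImE.
apply: is_derive_eq (is_deriveM (dE _) (dsin _)) _.
move: (cpow _ b) (ReE (1 - z)) (ImE (1 - z)) => w wR wI.
rewrite complexImN mulrA !complexImM !complexReM wR wI /= /GRing.scale /=; ring.
Qed.

Lemma normc_le_ReIm b : normc b <= `|complex.Re b| + `|complex.Im b|.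
Proof.
case: b => x y /=; rewrite -[leRHS]ger0_norm ?addr_ge0 // -sqrtr_sqr ler_wsqrtr //.
by rewrite sqrrD !real_normK ?num_real // addrAC lerDl mulrn_wge0 ?mulr_ge0.
Qed.

Lemma ler_Re_normc b : `|complex.Re b| <= normc b.
Proof.
by case: b => x y /=; rewrite -sqrtr_sqr ler_wsqrtr // lerDl sqr_ge0.
Qed.

Lemma ler_Im_normc b : `|complex.Im b| <= normc b.
Proof.
by case: b => x y /=; rewrite -sqrtr_sqr ler_wsqrtr // lerDr sqr_ge0.
Qed.

Lemma real_mean_value (f f' : R -> R) (rho K z : R) : 0 <= rho -> `|z| <= rho ->
  (forall x : R, `|x| <= rho -> is_derive x 1 f (f' x)) ->
  (forall x : R, `|x| <= rho -> `|f' x| <= K) -> `|f z - f 0| <= K * rho.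
Proof.
move=> rho0 zr df f'K.
have seg a c : a <= c -> `|a| <= rho -> `|c| <= rho -> exists2 x, `|x| <= rho &
    f c - f a = f' x * (c - a).
  rewrite !ler_norml => ac /andP[a1 a2] /andP[c1 c2].
  have inr x : x \in `[a, c] -> `|x| <= rho.
    by rewrite in_itv /= ler_norml => /andP[? ?]; apply/andP; split; lra.
  have [x xac E] : exists2 x, x \in `[a, c] & f c - f a = f' x * (c - a).
    apply: MVT_segment => //.
      by move=> x xac; apply: df; apply: inr; exact: subset_itv_oo_cc xac.
    by apply: derivable_within_continuous => x xac; have [] := df _ (inr _ xac).
  by exists x => //; exact: inr.
have K0 : 0 <= K by apply: le_trans (f'K z zr).
have bnd x : `|x| <= rho -> `|f' x * z| <= K * rho.
  by move=> xr; rewrite normrM ler_pM // f'K.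
have n0 : `|0 : R| <= rho by rewrite normr0.
have [z0|/ltW z0] := leP 0 z.
  by have [x xr ->] := seg 0 z z0 n0 zr; rewrite subr0; exact: bnd.
by have [x xr E] := seg z 0 z0 zr n0; rewrite distrC E sub0r mulrN normrN; exact: bnd.
Qed.

(** The mean value theorem gives different intermediate points for the real and the imaginary part;
    bounding the two separately costs the factor 2. *)
Lemma complex_mean_value (f f' : R -> R[i]) (rho K z : R) : 0 <= rho -> `|z| <= rho ->
  (forall x : R, `|x| <= rho -> is_cderive f x (f' x)) ->
  (forall x : R, `|x| <= rho -> normc (f' x) <= K) -> normc (f z - f 0) <= 2 * K * rho.
Proof.
move=> rho0 zr df f'K; apply: le_trans (normc_le_ReIm _) _.
rewrite -mulrA mulr_natl mulr2n; apply: lerD; rewrite ?(complexReD, complexImD) ?(complexReN, complexImN).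
  apply: (@real_mean_value (fun x => complex.Re (f x)) (fun x => complex.Re (f' x))) => // x xr.
    by have [] := df x xr.
  exact: le_trans (ler_Re_normc _) (f'K x xr).
apply: (@real_mean_value (fun x => complex.Im (f x)) (fun x => complex.Im (f' x))) => // x xr.
  by have [] := df x xr.
exact: le_trans (ler_Im_normc _) (f'K x xr).
Qed.

Definition binomial_sum b n z : R[i] :=
  \sum_(j < n) pochhammer b j / j`!%:R * (z ^+ j)%:C.

Lemma is_cderive_pow n z : is_cderive (fun x => (x ^+ n)%:C) z (n%:R * z ^+ n.-1)%:C.
Proof.
split => /=; last exact: is_derive_cst.
have := @is_deriveX R R id n z 1 1 (is_derive_id _ _).
by rewrite exprfctE => H; apply: is_derive_eq H _; rewrite /GRing.scale /= mulr1.
Qed.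

(** The full series solves (1 - z) f' = b f; truncation spoils only the coefficient of the top power
    z^n. *)
Lemma binomial_sum_derive b n z : exists2 d, is_cderive (binomial_sum b n.+1) z d &
  (1 - z)%:C * d - b * binomial_sum b n.+1 z =
  - (pochhammer b n.+1 / n`!%:R * (z ^+ n)%:C).
Proof.
elim: n => [|n [d dP dE]].
  exists 0.
    rewrite (_ : binomial_sum b 1 = fun=> 1); first exact: is_cderive_cst.
    by apply/funext => x; rewrite /binomial_sum big_ord1 pochhammer0 divr1 mulr1.
  rewrite /binomial_sum big_ord1 pochhammerS pochhammer0 divr1 !expr0 !mulr1 mulr0 sub0r.
  by rewrite addr0 mul1r divr1.
set c := pochhammer b n.+1 / n.+1`!%:R.
exists (d + (0 * (z ^+ n.+1)%:C + c * (n.+1%:R * z ^+ n)%:C)).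
  rewrite (_ : binomial_sum b n.+2 = fun x => binomial_sum b n.+1 x + c * (x ^+ n.+1)%:C).
    apply: is_cderiveD => //; apply: is_cderiveM; first exact: is_cderive_cst.
    exact: is_cderive_pow.
  by apply/funext => x; rewrite /binomial_sum big_ord_recr.
rewrite /binomial_sum big_ord_recr /= -/(binomial_sum b n.+1 z) -/c.
transitivity (((1 - z)%:C * d - b * binomial_sum b n.+1 z) +
   c * ((1 - z)%:C * (n.+1%:R * z ^+ n)%:C - b * (z ^+ n.+1)%:C)); first by ring.
rewrite dE; have -> : pochhammer b n.+1 / n`!%:R = n.+1%:R * c.
  by rewrite /c factS natrM invfM mulrCA mulVKf // pnatr_eq0.
have -> : pochhammer b n.+2 / n.+1`!%:R = c * (b + n.+1%:R).
  by rewrite pochhammerS /c; ring.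
rewrite exprS !rmorphM rmorphB /= rmorph_nat rmorph1; ring.
Qed.

(* The product of [cpow (1 - z) b] with the n-th partial sum of the binomial
   series has the small derivative
   [- cpow (1 - z) (b - 1) * pochhammer b n.+1 / n`! * z ^ n]. *)
Lemma binomial_uniform b (rho e : R) : 0 <= rho < 1 -> 0 < e -> exists n0, forall n,
  (n0 <= n)%N -> forall z : R, `|z| <= rho -> normc (binomial_sum b n z - cpow (1 - z) (- b)) <= e.
Proof.
move=> /andP[rho0 rho1] e0.
have m0 : 0 < 1 - rho by rewrite subr_gt0.
have mM : 1 - rho <= 1 + rho by lra.
have [C1 C10 HC1] := normc_cpow_bounded (b - 1) m0 mM.
have [C2 C20 HC2] := normc_cpow_bounded (- b) m0 mM.
have inI z : `|z| <= rho -> 1 - rho <= 1 - z <= 1 + rho.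
  by rewrite ler_norml => /andP[? ?]; apply/andP; split; lra.
(* The witness is r = 2 - rho, for which r rho = 1 - (1 - rho)^2. *)
have [r r1 rr] : exists2 r, 1 < r & 0 <= r * rho < 1.
  exists (1 + (1 - rho)); first lra.
  by apply/andP; split; nra.
(* The parameters [b + 1] and 1 come from (b)_(n+1) / n! = b (b + 1)_n / (1)_n. *)
have [M M0 HM] := @pochhammer_growth R (b + 1) 1 r ltr01 r1.
have [n0 Hn0] := expr_small (C2 * (2 * (C1 * (normc b * M)))) rr e0.
exists n0.+1 => -[//|n]; rewrite ltnS => n0n z zr.
pose D x := cpow (1 - x) b * binomial_sum b n.+1 x.
pose D' x := - (cpow (1 - x) (b - 1) * (pochhammer b n.+1 / n`!%:R * (x ^+ n)%:C)).
have dD x : `|x| <= rho -> is_cderive D x (D' x).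
  move=> xr; have [d dP dE] := binomial_sum_derive b n x.
  have x1 : x < 1 by move: xr; rewrite ler_norml => /andP[? ?]; lra.
  apply: is_cderive_eq (is_cderiveM (is_cderive_cpow b x1) dP) _.
  rewrite (_ : D' x = cpow (1 - x) (b - 1) * ((1 - x)%:C * d - b * binomial_sum b n.+1 x)).
    2: by rewrite dE mulrN.
  have -> : cpow (1 - x) b = cpow (1 - x) (b - 1) * (1 - x)%:C.
    by rewrite -[in RHS]cpow_nat1 ?subr_gt0 // -cpowD subrK.
  ring.
have D0 : D 0 = 1.
  rewrite /D subr0 cpow1 mul1r /binomial_sum big_ord_recl pochhammer0 divr1 mulr1.
  by rewrite big1 ?addr0 // => i _; rewrite expr0n mulr0.
have D'b x : `|x| <= rho -> normc (D' x) <= C1 * (normc b * (M * r ^+ n)) * rho ^+ n.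
  move=> xr; rewrite /D' (normcN (_ : Rcomplex R)) normcM -[leRHS]mulrA.
  rewrite ler_pM ?normc_ge0 ?HC1 ?inI // normcM ler_pM ?normc_ge0 //.
    rewrite pochhammerSl -mulrA normcM ler_wpM2l ?normc_ge0 //.
    by have := HM n; rewrite pochhammer1.
  by rewrite normcR normrX lerXn2r // nnegrE.
have := complex_mean_value rho0 zr dD D'b; rewrite D0 => H.
have -> : binomial_sum b n.+1 z - cpow (1 - z) (- b) = cpow (1 - z) (- b) * (D z - 1).
  by rewrite /D mulrBr mulr1 mulrA cpowNK mul1r.
rewrite normcM; apply: le_trans (ler_pM (normc_ge0 _) (normc_ge0 _) (HC2 _ (inI _ zr)) H) _.
apply: le_trans (Hn0 n n0n).
have P0 : 0 <= (C2 * (2 * (C1 * (normc b * M)))) * (r * rho) ^+ n.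
  apply: mulr_ge0; last by apply: exprn_ge0; case/andP: rr.
  by rewrite !mulr_ge0 ?normc_ge0 // ltW.
rewrite [leLHS](_ : _ = (C2 * (2 * (C1 * (normc b * M)))) * (r * rho) ^+ n * rho).
  by rewrite ler_piMr // ltW.
by rewrite exprMn; ring.
Qed.

End complex_powers.

(** * Expansion of the kernel *)

Section kernel_expansion.
Variable R : realType.
Implicit Types (a : R[i]) (t x y : R).

Lemma eventually_forall_lt (P : nat -> nat -> Prop) :
  (forall k, exists n0, forall n, (n0 <= n)%N -> P k n) ->
  forall K, exists n0, forall n, (n0 <= n)%N -> forall k, (k < K)%N -> P k n.
Proof.
move=> H; elim=> [|K [n0 Hn0]]; first by exists 0.
have [n1 Hn1] := H K; exists (maxn n0 n1) => n; rewrite geq_max => /andP[n0n n1n] k.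
by rewrite ltnS leq_eqVlt => /predU1P[->|kK]; [exact: Hn1|exact: Hn0].
Qed.

(** With t = tanh alpha this is Lambda / cosh^2 alpha to the power - a, see [cpow_Lambda]. *)
Definition zonal_kernel a t x y : R[i] :=
  cpow ((1 - t * (x * y)) ^+ 2 - t ^+ 2 * ((1 - x ^+ 2) * (1 - y ^+ 2))) (- a).

(* The kernel is [cpow (1 - z) (- 2 a) * cpow (1 - h) (- a)] with [z = t x y] and
   [0 <= h = t^2 (1 - x^2) (1 - y^2) / (1 - z)^2 <= t^2], because
   [(1 - x^2) (1 - y^2) <= (1 - |x y|)^2]. *)
Lemma zonal_kernel_approx a t (e : R) n0 : `|t| < 1 -> 0 < e ->
  exists K J, [/\ (n0 <= K)%N, (n0 <= J)%N & forall x y, `|x| <= 1 -> `|y| <= 1 ->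
    normc (\sum_(k < K) \sum_(j < 2 * J)
      (pochhammer a k / k`!%:R * (pochhammer (2 * a + (2 * k)%:R) j / j`!%:R)) *
      ((t ^+ 2) ^+ k * t ^+ j *
        ((x ^+ j * (1 - x ^+ 2) ^+ k) * (y ^+ j * (1 - y ^+ 2) ^+ k)))%:C
      - zonal_kernel a t x y) <= e].
Proof.
move=> t1 e0; have t01 : 0 <= `|t| < 1 by rewrite normr_ge0.
have T01 : 0 <= t ^+ 2 < 1.
  by rewrite sqr_ge0 -real_normK ?num_real // exprn_ilt1 // ?normr_ge0.
have m0 : 0 < 1 - `|t| by rewrite subr_gt0.
have mM : 1 - `|t| <= 1 + `|t| by have := normr_ge0 t; lra.
have [C C0 HC] := normc_cpow_bounded (- (2 * a)) m0 mM.
(* Truncation in k is multiplied by (1 - z)^(-2a), of norm at most [C]. Truncation in j is weighted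
   by the [c k], whose sum is at most [B]; as [B] depends on [K], [K] is fixed before the bound on
   j. *)
have e1 : 0 < e / 2 / C by rewrite !divr_gt0.
have [K0 HK0] := binomial_uniform a T01 e1.
pose K := maxn n0 K0.
pose c k := normc (pochhammer a k / k`!%:R).
have c0 k : 0 <= c k by exact: normc_ge0.
pose B := 1 + \sum_(k < K) c k.
have B0 : 0 < B by rewrite ltr_wpDr // sumr_ge0.
have e2 : 0 < e / 2 / B by rewrite !divr_gt0.
have [J0 HJ0] := eventually_forall_lt
  (fun k => binomial_uniform (2 * a + (2 * k)%:R) t01 e2) K.
exists K, (maxn n0 J0); split; [exact: leq_maxl|exact: leq_maxl|] => x y x1 y1.
set J := (2 * maxn n0 J0)%N.
have J0J : (J0 <= J)%N by rewrite /J mul2n -addnn (leq_trans (leq_maxr n0 J0)) ?leq_addr.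
pose z := t * (x * y); pose v := (1 - x ^+ 2) * (1 - y ^+ 2).
have xy1 : `|x * y| <= 1 by rewrite normrM mulr_ile1.
have zt : `|z| <= `|t| by rewrite normrM ler_piMr.
have z01 : 1 - `|t| <= 1 - z <= 1 + `|t|.
  by move: zt; rewrite ler_norml => /andP[? ?]; apply/andP; split; lra.
have z0 : 0 < 1 - z by case/andP: z01 => *; lra.
have X1 : x ^+ 2 <= 1 by rewrite -real_normK ?num_real // exprn_ile1.
have Y1 : y ^+ 2 <= 1 by rewrite -real_normK ?num_real // exprn_ile1.
have v0 : 0 <= v by rewrite mulr_ge0 ?subr_ge0.
have vz : v <= (1 - z) ^+ 2.
  apply: (@le_trans _ _ ((1 - `|x * y|) ^+ 2)).
    rewrite /v normrM -[x ^+ 2]real_normK ?num_real // -[y ^+ 2]real_normK ?num_real //.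
    by rewrite -subr_ge0 (_ : _ - _ = (`|x| - `|y|) ^+ 2) ?sqr_ge0 //; ring.
  rewrite ler_sqr ?nnegrE ?subr_ge0 //; last by lra.
  rewrite lerD2l lerN2; apply: le_trans (ler_norm _) _.
  by rewrite /z normrM ler_piMl // ltW.
have w0 : 0 <= t ^+ 2 * v by rewrite mulr_ge0 // sqr_ge0.
have w1 : t ^+ 2 * v <= 1.
  apply: mulr_ile1 => //; [exact: sqr_ge0|by case/andP: T01 => _ /ltW|].
  by apply: mulr_ile1; rewrite ?subr_ge0 // gerBl sqr_ge0.
pose h := t ^+ 2 * v / (1 - z) ^+ 2.
have q0 : 0 < (1 - z) ^+ 2 by rewrite exprn_gt0.
have h0 : 0 <= h by apply: divr_ge0 => //; exact: ltW.
have hT : `|h| <= t ^+ 2.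
  by rewrite ger0_norm // /h ler_pdivrMr // ler_wpM2l // sqr_ge0.
have h1 : 0 < 1 - h.
  have := ler_norm h; case/andP: T01 => *; lra.
have kE : zonal_kernel a t x y = cpow (1 - z) (- (2 * a)) * cpow (1 - h) (- a).
  rewrite /zonal_kernel -/z -/v.
  have -> : (1 - z) ^+ 2 - t ^+ 2 * v = (1 - z) * (1 - z) * (1 - h).
    by rewrite /h; field; rewrite lt0r_neq0.
  rewrite cpowM ?mulr_gt0 // cpowM // -cpowD; congr (cpow _ _ * _); ring.
have kS : cpow (1 - z) (- (2 * a)) * binomial_sum a K h = \sum_(k < K)
    pochhammer a k / k`!%:R * ((t ^+ 2 * v) ^+ k)%:C * cpow (1 - z) (- (2 * a + (2 * k)%:R)).
  rewrite mulr_sumr; apply: eq_bigr => k _.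
  rewrite opprD cpowD cpow_natN //; move: (cpow _ _) (pochhammer a k / _) => P d.
  rewrite (_ : h ^+ k = (t ^+ 2 * v) ^+ k * (1 - z) ^- (2 * k)); last first.
    by rewrite /h expr_div_n -exprM.
  by rewrite rmorphM; ring.
set A := \sum_(k < K) _; pose A' := cpow (1 - z) (- (2 * a)) * binomial_sum a K h.
have E1 : normc (A - A') <= e / 2.
  rewrite /A' kS /A -sumrB.
  rewrite (eq_bigr (fun k : 'I_K => pochhammer a k / k`!%:R * ((t ^+ 2 * v) ^+ k)%:C *
     (binomial_sum (2 * a + (2 * k)%:R) J z - cpow (1 - z) (- (2 * a + (2 * k)%:R))))).
    2: { move=> k _; rewrite mulrBr; congr (_ - _); rewrite mulr_sumr.
      apply: eq_bigr => j _.
      rewrite (_ : (t ^+ 2) ^+ k * t ^+ j * _ = (t ^+ 2 * v) ^+ k * z ^+ j).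
        by rewrite rmorphM; ring.
      by rewrite /v /z !exprMn; ring. }
  apply: le_trans (normc_sum _ _ _) _.
  apply: (@le_trans _ _ (\sum_(k < K) c k * (e / 2 / B))).
    apply: ler_sum => k _; rewrite normcM ler_pM ?normc_ge0 //; last exact: HJ0.
    rewrite normcM ler_piMr ?normc_ge0 // normcR ger0_norm; first exact: exprn_ile1.
    exact: exprn_ge0.
  rewrite -mulr_suml mulrCA; apply: ler_piMr; first by rewrite ltW // divr_gt0.
  by rewrite ler_pdivrMr // mul1r lerDr.
have E2 : normc (A' - zonal_kernel a t x y) <= e / 2.
  rewrite kE /A' -mulrBr normcM.
  rewrite -[leRHS](divfK (lt0r_neq0 C0)) [leRHS]mulrC.
  by rewrite ler_pM ?normc_ge0 // ?HC // HK0 // leq_maxr.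
by have := normc_triangle A' A (zonal_kernel a t x y); lra.
Qed.

End kernel_expansion.

(** * Iterated integrals of uniform limits *)

Section bounded_measurable.
Local Open Scope classical_set_scope.
Variable R : realType.

(** Unlike integrability, this is stable under products and uniform limits; on a measurable subset
    of a probability space it implies integrability. *)
Definition bmeasurable d (T : measurableType d) (D : set T) (f : T -> R) : Prop :=
  measurable_fun D f /\ exists M : R, forall x, D x -> `|f x| <= M.

Section one_space.
Context d (T : measurableType d) (P : probability T R).
Variable D : set T.
Hypothesis mD : measurable D.
Implicit Types f g : T -> R.

Lemma bmeasurable_integrable f : bmeasurable D f -> P.-integrable D (EFin \o f).
Proof.
move=> [mf [M HM]]; apply: measurable_bounded_integrable => //.
  by rewrite (le_lt_trans (probability_le1 P mD)) // ltry.
exists M; split; first exact: num_real.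
by move=> y My x Dx; apply: le_trans (HM x Dx) (ltW My).
Qed.

Lemma bmeasurable_cst c : bmeasurable D (fun=> c).
Proof. by split; [exact: measurable_cst|exists `|c|]. Qed.

Lemma bmeasurableD f g :
  bmeasurable D f -> bmeasurable D g -> bmeasurable D (fun x => f x + g x).
Proof.
move=> [mf [M HM]] [mg [N HN]]; split; first exact: measurable_funD.
exists (M + N) => x Dx; apply: le_trans (ler_normD _ _) _.
by rewrite lerD ?HM ?HN.
Qed.

Lemma bmeasurableM f g :
  bmeasurable D f -> bmeasurable D g -> bmeasurable D (fun x => f x * g x).
Proof.
move=> [mf [M HM]] [mg [N HN]]; split; first exact: measurable_funM.
by exists (M * N) => x Dx; rewrite normrM ler_pM ?HM ?HN.
Qed.

Lemma bmeasurableX f n : bmeasurable D f -> bmeasurable D (fun x => f x ^+ n).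
Proof.
move=> bf; elim: n => [|n IHn]; first exact: bmeasurable_cst.
rewrite (_ : (fun x => _) = fun x => f x * f x ^+ n); first exact: bmeasurableM.
by apply/funext => x; rewrite exprS.
Qed.

Lemma bmeasurable_sum I (r : seq I) (f : I -> T -> R) :
  (forall i, bmeasurable D (f i)) -> bmeasurable D (fun x => \sum_(i <- r) f i x).
Proof.
move=> bf; elim: r => [|i r IHr].
  rewrite (_ : (fun x => _) = fun=> 0); first exact: bmeasurable_cst.
  by apply/funext => x; rewrite big_nil.
rewrite (_ : (fun x => _) = fun x => f i x + \sum_(j <- r) f j x).
  exact: bmeasurableD.
by apply/funext => x; rewrite big_cons.
Qed.

Lemma RintegralZ c f : bmeasurable D f ->
  \int[P]_(x in D) (c * f x) = c * \int[P]_(x in D) f x.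
Proof. by move=> bf; apply: RintegralZl => //; exact: bmeasurable_integrable. Qed.

Lemma Rintegral_sum I (r : seq I) (f : I -> T -> R) :
  (forall i, bmeasurable D (f i)) ->
  \int[P]_(x in D) (\sum_(i <- r) f i x) = \sum_(i <- r) \int[P]_(x in D) f i x.
Proof.
move=> bf; elim: r => [|i r IHr].
  under eq_Rintegral do rewrite big_nil.
  by rewrite big_nil Rintegral_cst // mul0r.
under eq_Rintegral do rewrite big_cons.
rewrite big_cons -IHr RintegralD //; apply: bmeasurable_integrable => //.
exact: bmeasurable_sum.
Qed.

Lemma bmeasurable_uniform f :
  (forall e : R, 0 < e -> exists2 g, bmeasurable D g & forall x, D x -> `|f x - g x| <= e) ->
  bmeasurable D f.
Proof.
move=> H; have /choice [g Hg] : forall n : nat, exists g, bmeasurable D g /\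
    forall x, D x -> `|f x - g x| <= n.+1%:R^-1.
  by move=> n; have [|g bg Hg] := H n.+1%:R^-1; [rewrite invr_gt0|exists g].
split; last first.
  have [[_ [M HM]] H0] := Hg 0; exists (M + 1) => x Dx.
  rewrite -(subrK (g 0 x) (f x)) addrC; apply: le_trans (ler_normD _ _) _.
  by rewrite lerD ?HM // (le_trans (H0 x Dx)) // invr1.
apply: (@measurable_fun_cvg _ _ _ _ g) => [n|x Dx]; first by case: (Hg n) => -[].
apply/cvgrPdist_le => /= e e0.
exists (Num.truncn e^-1) => // n /= en; apply: le_trans (proj2 (Hg n) x Dx) _.
rewrite -[leRHS]invrK lef_pV2 ?posrE ?invr_gt0 //.
by apply: le_trans (ltW (truncnS_gt _)) _; rewrite ler_nat.
Qed.

Lemma Rintegral_dist_le f g (e : R) : bmeasurable D f -> bmeasurable D g -> 0 <= e ->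
  (forall x, D x -> `|f x - g x| <= e) ->
  `|\int[P]_(x in D) f x - \int[P]_(x in D) g x| <= e.
Proof.
move=> bf bg e0 H.
have bfg : bmeasurable D (fun x => f x - g x).
  rewrite (_ : (fun x => _) = fun x => f x + -1 * g x).
    by apply: bmeasurableD => //; apply: bmeasurableM => //; exact: bmeasurable_cst.
  by apply/funext => x; rewrite mulN1r.
rewrite -RintegralB //; try exact: bmeasurable_integrable.
apply: le_trans (le_normr_Rintegral _ _) _ => //; first exact: bmeasurable_integrable.
apply: (@le_trans _ _ (\int[P]_(x in D) e)).
  apply: le_Rintegral => //; last exact: bmeasurable_integrable (bmeasurable_cst _).
  have [m [M HM]] := bfg; apply: bmeasurable_integrable; split.
    exact: measurableT_comp.
  by exists M => x Dx; rewrite normr_id HM.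
rewrite Rintegral_cst // ler_piMr //.
by rewrite -lee_fin fineK ?probability_le1 // fin_num_measure.
Qed.

End one_space.

Section two_spaces.
Context d1 d2 (T1 : measurableType d1) (T2 : measurableType d2).
Variables (P1 : probability T1 R) (P2 : probability T2 R).
Variables (D1 : set T1) (D2 : set T2).
Hypotheses (mD1 : measurable D1) (mD2 : measurable D2).
Variables (I : Type) (f : I -> T1 -> R) (g : I -> T2 -> R).
Hypotheses (bf : forall i, bmeasurable D1 (f i)) (bg : forall i, bmeasurable D2 (g i)).
Implicit Type F : T1 -> T2 -> R.

Let separable (r : seq I) (c : I -> R) u v := \sum_(i <- r) c i * (f i u * g i v).

(** Approximability at every precision supplies the measurability of [F u] and of the inner
    integral, while the given [r] and [c] yield the estimate at precision [e]. The integrals are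
    never exchanged. *)
Lemma Rintegral2_approx F (r : seq I) (c : I -> R) (e : R) :
  (forall e : R, 0 < e -> exists r c,
     forall u v, D1 u -> D2 v -> `|F u v - separable r c u v| <= e) ->
  0 <= e -> (forall u v, D1 u -> D2 v -> `|F u v - separable r c u v| <= e) ->
  `|\int[P1]_(u in D1) \int[P2]_(v in D2) F u v -
    \sum_(i <- r) c i * ((\int[P1]_(u in D1) f i u) * \int[P2]_(v in D2) g i v)| <= e.
Proof.
move=> HF e0 He.
have bsep r' c' u : bmeasurable D2 (separable r' c' u).
  apply: bmeasurable_sum => i; apply: bmeasurableM; first exact: bmeasurable_cst.
  by apply: bmeasurableM => //; exact: bmeasurable_cst.
have bF u : D1 u -> bmeasurable D2 (F u).
  move=> Du; apply: bmeasurable_uniform => e' e'0; have [r' [c' H]] := HF e' e'0.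
  by exists (separable r' c' u) => // v Dv; exact: H.
pose J (r' : seq I) (c' : I -> R) u :=
  \sum_(i <- r') (c' i * \int[P2]_(v in D2) g i v) * f i u.
have JE r' c' u : \int[P2]_(v in D2) separable r' c' u v = J r' c' u.
  rewrite Rintegral_sum //; last first.
    move=> i; apply: bmeasurableM; first exact: bmeasurable_cst.
    by apply: bmeasurableM => //; exact: bmeasurable_cst.
  apply: eq_bigr => i _; rewrite -mulrA [_ * f i u]mulrC mulrA -RintegralZ //.
  by apply: eq_Rintegral => v _; rewrite mulrA.
have bJ r' c' : bmeasurable D1 (J r' c').
  by apply: bmeasurable_sum => i; apply: bmeasurableM => //; exact: bmeasurable_cst.
have inner r' c' (e' : R) : 0 <= e' ->
    (forall u v, D1 u -> D2 v -> `|F u v - separable r' c' u v| <= e') ->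
    forall u, D1 u -> `|\int[P2]_(v in D2) F u v - J r' c' u| <= e'.
  move=> e'0 H u Du; rewrite -JE; apply: Rintegral_dist_le => //; first exact: bF.
  by move=> v Dv; exact: H.
have -> : \sum_(i <- r) c i * ((\int[P1]_(u in D1) f i u) * \int[P2]_(v in D2) g i v) =
    \int[P1]_(u in D1) J r c u.
  rewrite Rintegral_sum //; last first.
    by move=> i; apply: bmeasurableM => //; exact: bmeasurable_cst.
  by apply: eq_bigr => i _; rewrite RintegralZ //; ring.
apply: Rintegral_dist_le => //; last exact: inner.
apply: bmeasurable_uniform => e' e'0; have [r' [c' H]] := HF e' e'0.
by exists (J r' c') => //; apply: inner => //; exact: ltW.
Qed.

(** The real and the imaginary part contribute an error [e] each. *)
Lemma cintegral2_approx (F : T1 -> T2 -> R[i]) (r : seq I) (c : I -> R[i]) (e : R) :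
  (forall e : R, 0 < e -> exists r c, forall u v, D1 u -> D2 v ->
     normc (\sum_(i <- r) c i * (f i u * g i v)%:C - F u v) <= e) ->
  0 <= e -> (forall u v, D1 u -> D2 v ->
     normc (\sum_(i <- r) c i * (f i u * g i v)%:C - F u v) <= e) ->
  normc (\sum_(i <- r) c i *
     ((\int[P1]_(u in D1) f i u) * \int[P2]_(v in D2) g i v)%:C -
     cintegral P1 D1 (fun u => cintegral P2 D2 (F u))) <= e + e.
Proof.
have ReS (s : seq I) (h : I -> R) (k : I -> R[i]) :
    complex.Re (\sum_(i <- s) k i * (h i)%:C) = \sum_(i <- s) complex.Re (k i) * h i.
  elim: s => [|i s IHs]; first by rewrite !big_nil.
  by rewrite !big_cons complexReD IHs complexReM /= mulr0 subr0.
have ImS (s : seq I) (h : I -> R) (k : I -> R[i]) :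
    complex.Im (\sum_(i <- s) k i * (h i)%:C) = \sum_(i <- s) complex.Im (k i) * h i.
  elim: s => [|i s IHs]; first by rewrite !big_nil.
  by rewrite !big_cons complexImD IHs complexImM /= mulr0 add0r.
move=> HF e0 He.
have toRe s (k : I -> R[i]) (e' : R) :
    (forall u v, D1 u -> D2 v -> normc (\sum_(i <- s) k i * (f i u * g i v)%:C - F u v) <= e') ->
    forall u v, D1 u -> D2 v ->
      `|complex.Re (F u v) - separable s (fun i => complex.Re (k i)) u v| <= e'.
  move=> H u v Du Dv; apply: le_trans (H u v Du Dv); rewrite distrC.
  by apply: le_trans (ler_Re_normc _); rewrite complexReD complexReN ReS.
have toIm s (k : I -> R[i]) (e' : R) :
    (forall u v, D1 u -> D2 v -> normc (\sum_(i <- s) k i * (f i u * g i v)%:C - F u v) <= e') ->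
    forall u v, D1 u -> D2 v ->
      `|complex.Im (F u v) - separable s (fun i => complex.Im (k i)) u v| <= e'.
  move=> H u v Du Dv; apply: le_trans (H u v Du Dv); rewrite distrC.
  by apply: le_trans (ler_Im_normc _); rewrite complexImD complexImN ImS.
apply: le_trans (normc_le_ReIm _) _; rewrite !(complexReD, complexImD) !(complexReN, complexImN) ReS ImS /=.
apply: lerD; rewrite distrC.
  apply: (@Rintegral2_approx (fun u v => complex.Re (F u v)) r) => //; last exact: toRe.
  by move=> e' /HF[s [k H]]; exists s, (fun i => complex.Re (k i)); exact: toRe.
apply: (@Rintegral2_approx (fun u v => complex.Im (F u v)) r) => //; last exact: toIm.
by move=> e' /HF[s [k H]]; exists s, (fun i => complex.Im (k i)); exact: toIm.
Qed.

End two_spaces.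
End bounded_measurable.

(** * Moments of a coordinate on the sphere *)

Section sphere_moments.
Local Open Scope classical_set_scope.
Variables (R : realType) (d : nat).
Hypothesis d0 : (0 < d)%N.
Local Notation P := (sphere_measure R d).
Local Notation D := (sphere R d).
Implicit Types (i j : 'I_d) (f : d.-tuple R -> R).

Lemma measurable_sphere : measurable D.
Proof.
rewrite -[X in measurable X]setTI (_ : D =
    (fun t : d.-tuple R => \sum_(i < d) tnth t i ^+ 2) @^-1` [set 1]) //.
have mN : measurable_fun setT (fun t : d.-tuple R => \sum_(i < d) tnth t i ^+ 2).
  by apply: measurable_sum => i; apply: measurable_funX; exact: measurable_tnth'.
by apply: mN => //; exact: measurable_set1.
Qed.
Let mD := measurable_sphere.

Lemma sphere_coord_le1 i u : D u -> `|tnth u i| <= 1.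
Proof.
move=> Du; rewrite -(@expr_le1 _ 2) // real_normK ?num_real // -Du (bigD1 i) //= lerDl.
by apply: sumr_ge0 => j _; exact: sqr_ge0.
Qed.

Lemma bmeasurable_coord i : bmeasurable D (fun u => tnth u i).
Proof.
split; first by apply: measurable_funTS; exact: measurable_tnth'.
by exists 1 => u; exact: sphere_coord_le1.
Qed.

Lemma bmeasurable_one_sub_sqr i : bmeasurable D (fun u => 1 - tnth u i ^+ 2).
Proof.
rewrite (_ : (fun u => _) = fun u : d.-tuple R => 1 + -1 * tnth u i ^+ 2).
  apply: bmeasurableD; first exact: bmeasurable_cst.
  apply: bmeasurableM; first exact: bmeasurable_cst.
  by apply: bmeasurableX; exact: bmeasurable_coord.
by apply/funext => x; rewrite mulN1r.
Qed.

Lemma sphere_invariant (Q : 'M[R]_d) f : Q^T *m Q = 1%:M -> bmeasurable D f ->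
  measurable_fun setT f ->
  \int[P]_(u in D) f (mx_act Q u) = \int[P]_(u in D) f u.
Proof.
move=> QQ bf mf; have [_ Pinv] := sphere_measureP R d0.
have mQ := @measurable_mx_act R d Q.
have QD : mx_act Q @^-1` D = D.
  by apply/seteqP; split => u; rewrite /sphere /= sum_sqr_mx_act.
rewrite /Rintegral; congr fine; apply/esym.
transitivity (\int[pushforward P (mx_act Q)]_(u in D) (f u)%:E)%E.
  by apply: eq_measure_integral => A mA _; rewrite /pushforward; apply/esym; exact: Pinv.
rewrite integral_pushforward ?QD //; first exact/measurable_EFinP.
apply: (@bmeasurable_integrable _ _ _ P D mD (f \o mx_act Q)); split.
  by apply: measurable_funTS; exact: measurableT_comp.
have [_ [M HM]] := bf; exists M => u Du; apply: HM.
by move: Du; rewrite -{1}QD.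
Qed.

Lemma trmx_mul_self_col (w : 'cV[R]_d) : w^T *m w = (\sum_i w i ord0 ^+ 2)%:M.
Proof.
by rewrite [LHS]mx11_scalar mxE; congr _%:M; apply: eq_bigr => i _; rewrite mxE expr2.
Qed.

(* Householder reflection exchanging the i-th basis vector and [v]. *)
Lemma orthogonal_row i (v : 'I_d -> R) : \sum_k v k ^+ 2 = 1 ->
  exists2 Q : 'M[R]_d, Q^T *m Q = 1%:M & forall k, Q i k = v k.
Proof.
move=> v1; pose w : 'cV[R]_d := \col_k ((k == i)%:R - v k).
pose n := \sum_k w k ord0 ^+ 2.
have nE : n = 2 - 2 * v i.
  rewrite /n (eq_bigr (fun k => ((k == i)%:R - 2 * ((k == i)%:R * v k)) + v k ^+ 2)).
    rewrite big_split /= v1 sumrB -mulr_sumr (bigD1 i) //= eqxx [X in _ - 2 * X](bigD1 i) //=.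
    rewrite eqxx mul1r !big1 ?addr0; first by ring.
      by move=> k ki; rewrite (negbTE ki) mul0r.
    by move=> k ki; rewrite (negbTE ki).
  by move=> k _; rewrite mxE; case: (k == i) => /=; ring.
(* If n = 0, then [v] is the i-th basis vector; no reflection is defined, and the identity
   serves. *)
have [n0|n0] := eqVneq n 0.
  exists 1%:M; first by rewrite trmx1 mulmx1.
  move=> k; have : \sum_k w k ord0 ^+ 2 = 0 by [].
  move/eqP; rewrite psumr_eq0; last by move=> *; exact: sqr_ge0.
  move=> /allP /(_ k (mem_index_enum _)) /=.
  by rewrite sqrf_eq0 !mxE subr_eq0 eq_sym => /eqP ->; rewrite eq_sym.
exists (1%:M - (2 / n) *: (w *m w^T)).
  have -> : (1%:M - (2 / n) *: (w *m w^T))^T = 1%:M - (2 / n) *: (w *m w^T).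
    apply/matrixP => a b; rewrite !mxE !big_ord1 !mxE [b == a]eq_sym.
    by congr (_ - _ * _); rewrite mulrC.
  rewrite mulmxBl mul1mx mulmxBr mulmx1 -scalemxAl -scalemxAr scalerA.
  have -> : w *m w^T *m (w *m w^T) = n *: (w *m w^T).
    by rewrite -mulmxA [w^T *m (w *m _)]mulmxA trmx_mul_self_col mul_scalar_mx -scalemxAr.
  rewrite scalerA (_ : 2 / n * (2 / n) * n = 2 / n + 2 / n); last by field.
  by rewrite scalerDl opprB !addrA subrK addrK.
move=> k; rewrite !mxE big_ord1 !mxE eqxx mulrA.
rewrite nE in n0 *; have -> : 2 / (2 - 2 * v i) * (1 - v i) = 1 by field.
by rewrite mul1r eq_sym; ring.
Qed.

Lemma tnth_mx_act (Q : 'M[R]_d) (u : d.-tuple R) i :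
  tnth (mx_act Q u) i = \sum_j Q i j * tnth u j.
Proof. by rewrite tnth_mktuple. Qed.

Lemma sphere_rotate_coord (v : 'I_d -> R) i N : \sum_k v k ^+ 2 = 1 ->
  \int[P]_(u in D) (\sum_k v k * tnth u k) ^+ N = \int[P]_(u in D) tnth u i ^+ N.
Proof.
move=> v1; have [Q QQ Qv] := orthogonal_row i v1.
rewrite -(sphere_invariant QQ (f := fun u => tnth u i ^+ N)).
- by apply: eq_Rintegral => u _; rewrite tnth_mx_act; congr (_ ^+ _); apply: eq_bigr => k _; rewrite Qv.
- by apply: bmeasurableX; exact: bmeasurable_coord.
- by apply: measurable_funX; exact: measurable_tnth'.
Qed.

(** Antipodal symmetry: the matrix -1 is orthogonal for every d, and the integrand is odd. *)
Lemma sphere_odd_moment i (j k : nat) : odd j ->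
  \int[P]_(u in D) (tnth u i ^+ j * (1 - tnth u i ^+ 2) ^+ k) = 0.
Proof.
move=> oj; set f := fun u : d.-tuple R => _.
have bf : bmeasurable D f.
  apply: bmeasurableM; apply: bmeasurableX; first exact: bmeasurable_coord.
  exact: bmeasurable_one_sub_sqr.
have mf : measurable_fun setT f.
  apply: measurable_funM; apply: measurable_funX; first exact: measurable_tnth'.
  by apply: measurable_funB => //; apply: measurable_funX; exact: measurable_tnth'.
have QQ : (- 1%:M : 'M[R]_d)^T *m - 1%:M = 1%:M.
  have -> : (- 1%:M : 'M[R]_d)^T = - 1%:M by apply/matrixP => a b; rewrite !mxE eq_sym.
  by rewrite mulmxN mulNmx opprK mulmx1.
have := sphere_invariant QQ bf mf.
have -> : \int[P]_(u in D) f (mx_act (- 1%:M) u) = \int[P]_(u in D) (-1 * f u).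
  apply: eq_Rintegral => u _; rewrite /f tnth_mx_act.
  have -> : \sum_j (- 1%:M : 'M[R]_d) i j * tnth u j = - tnth u i.
    rewrite (bigD1 i) //= !mxE eqxx big1 ?addr0 ?mulN1r // => l li.
    by rewrite !mxE eq_sym (negbTE li) mulr0n oppr0 mul0r.
  by rewrite sqrrN exprNn -signr_odd oj expr1 -mulrA.
by rewrite RintegralZ // => E; lra.
Qed.

Lemma poly_eq0_all (p : {poly R}) : (forall x, p.[x] = 0) -> p = 0.
Proof.
move=> H; apply: (@roots_geq_poly_eq0 _ p [seq (k%:R : R) | k <- iota 0 (size p)]).
- by apply/allP => x _; rewrite /root H.
- by rewrite map_inj_uniq ?iota_uniq // => m n /eqP; rewrite eqr_nat => /eqP.
- by rewrite size_map size_iota.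
Qed.

(* Coefficient of [tau ^ 2] in
   [E (u_i + tau u_j)^(2n+2) = (1 + tau^2)^(n+1) E u_i^(2n+2)]. *)
Lemma sphere_mixed_moment i j n : i != j ->
  (2 * n).+1%:R * \int[P]_(u in D) (tnth u i ^+ (2 * n) * tnth u j ^+ 2) =
  \int[P]_(u in D) tnth u i ^+ (2 * n.+1).
Proof.
move=> ij; set N := (2 * n.+1)%N; set e := \int[P]_(u in D) tnth u i ^+ N.
pose M k := \int[P]_(u in D) (tnth u i ^+ (N - k) * tnth u j ^+ k).
have bM k : bmeasurable D (fun u : d.-tuple R => tnth u i ^+ (N - k) * tnth u j ^+ k).
  by apply: bmeasurableM; apply: bmeasurableX; exact: bmeasurable_coord.
have mom tau : \sum_(k < N.+1) 'C(N, k)%:R * M k * tau ^+ k = (1 + tau ^+ 2) ^+ n.+1 * e.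
  have s0 : 0 < 1 + tau ^+ 2 by rewrite ltr_pwDl // sqr_ge0.
  (* [s] is the length of e_i + tau e_j, and [v] below is the unit vector in that direction. *)
  pose s := Num.sqrt (1 + tau ^+ 2).
  have s2 : s ^+ 2 = 1 + tau ^+ 2 by rewrite sqr_sqrtr // ltW.
  have sn0 : s != 0 by rewrite sqrtr_eq0 -ltNge.
  pose v (k : 'I_d) := ((k == i)%:R + tau * (k == j)%:R) / s.
  have vE (h : 'I_d -> R) : \sum_k ((k == i)%:R + tau * (k == j)%:R) * h k = h i + tau * h j.
    under eq_bigr do rewrite mulrDl -mulrA.
    rewrite big_split /= -mulr_sumr (bigD1 i) //= [X in _ + tau * X](bigD1 j) //=.
    rewrite !eqxx !mul1r !big1 ?addr0 // => k /negbTE ->; exact: mul0r.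
  have v1 : \sum_k v k ^+ 2 = 1.
    rewrite (eq_bigr (fun k => ((k == i)%:R + tau * (k == j)%:R) *
       (((k == i)%:R + tau * (k == j)%:R) / s ^+ 2))) => [|k _]; last first.
      by rewrite /v expr_div_n expr2 mulrA.
    rewrite vE !eqxx [j == i]eq_sym (negbTE ij) s2 mulr0 mulr1 addr0 add0r /=.
    by field; exact: lt0r_neq0.
  rewrite /e -(sphere_rotate_coord i N v1).
  transitivity (s ^+ N * \int[P]_(u in D) (\sum_k v k * tnth u k) ^+ N); last first.
    by rewrite /N exprM s2.
  rewrite -RintegralZ //; last first.
    apply: bmeasurableX; apply: bmeasurable_sum => k; apply: bmeasurableM.
      exact: bmeasurable_cst.
    exact: bmeasurable_coord.
  rewrite (@eq_Rintegral _ _ _ _ _ (fun u : d.-tuple R => \sum_(k < N.+1)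
     ('C(N, k)%:R * tau ^+ k) * (tnth u i ^+ (N - k) * tnth u j ^+ k))); last first.
    move=> u _; rewrite -exprMn mulr_sumr.
    rewrite (_ : \sum_k _ = tnth u i + tau * tnth u j).
      rewrite exprDn; apply: eq_bigr => k _; rewrite exprMn -mulr_natl; ring.
    by rewrite -vE; apply: eq_bigr => k _; rewrite /v mulrA [s * _]mulrC divfK.
  rewrite Rintegral_sum //; last first.
    by move=> k; apply: bmeasurableM => //; exact: bmeasurable_cst.
  by apply: eq_bigr => k _; rewrite RintegralZ //; rewrite /M; ring.
(* [mom] holds for all real tau, hence as an identity of polynomials; in degree 2 it reads C(2n+2,
   2) M_2 = (n + 1) e, where C(2n+2, 2) = (n + 1) (2n + 1). *)
pose p : {poly R} := \poly_(k < N.+1) ('C(N, k)%:R * M k) - e%:P * (1 + 'X^2) ^+ n.+1.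
have p0 : p = 0.
  apply: poly_eq0_all => x; rewrite /p !hornerE horner_poly mom; ring.
have : p`_2 = 0 by rewrite p0 coef0.
rewrite /p coefB coef_poly coefCM exprDn coef_sum (bigD1 (Ordinal (isT : (1 < n.+2)%N))) //=.
rewrite big1 ?addr0; last first.
  move=> k k1; rewrite expr1n mul1r -exprM coefMn coefXn.
  rewrite (_ : (2 == 2 * k)%N = false) ?mul0rn //.
  by apply: contraNF k1 => /eqP E; apply/eqP/val_inj => /=; lia.
rewrite expr1n mul1r coefMn coefXn eqxx bin1.
rewrite (_ : (2 < N.+1)%N) /=; last by rewrite /N; lia.
have -> : 'C(N, 2)%:R = n.+1%:R * (2 * n).+1%:R :> R.
  by rewrite -natrM; congr _%:R; rewrite bin2 /N; lia.
have -> : M 2 = \int[P]_(u in D) (tnth u i ^+ (2 * n) * tnth u j ^+ 2).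
  by rewrite /M (_ : (N - 2 = 2 * n)%N) // /N; lia.
move=> H; apply: (mulfI (_ : n.+1%:R != 0 :> R)); first by rewrite pnatr_eq0.
by rewrite mulrA [RHS]mulrC; apply/eqP; rewrite -subr_eq0; apply/eqP.
Qed.

(** Inserting 1 = sum of the u_j^2 into the moment of order 2n gives e = e' + (d - 1) e' / (2n + 1)
    by the mixed moments; this is solved for e'. *)
Lemma sphere_even_moment i n : \int[P]_(u in D) tnth u i ^+ (2 * n.+1) =
  (1 / 2 + n%:R) / (d%:R / 2 + n%:R) * \int[P]_(u in D) tnth u i ^+ (2 * n).
Proof.
set e := \int[P]_(u in D) tnth u i ^+ (2 * n).
set e' := \int[P]_(u in D) tnth u i ^+ (2 * n.+1).
have bc j k : bmeasurable D (fun u : d.-tuple R => tnth u i ^+ k * tnth u j ^+ 2).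
  by apply: bmeasurableM; apply: bmeasurableX; exact: bmeasurable_coord.
have E : e = e' + (d%:R - 1) * (e' / (2 * n).+1%:R).
  rewrite /e (@eq_Rintegral _ _ _ _ _ (fun u : d.-tuple R => \sum_j tnth u i ^+ (2 * n) * tnth u j ^+ 2)).
    rewrite Rintegral_sum // (bigD1 i) //=; congr (_ + _).
      apply: eq_Rintegral => u _; rewrite -exprD; congr (_ ^+ _); lia.
    rewrite (eq_bigr (fun=> e' / (2 * n).+1%:R)).
      rewrite sumr_const -[LHS]mulr_natl; congr (_ * _).
      have := cardC1 i; rewrite card_ord => ->.
      by rewrite -subn1 natrB.
    move=> j ji; rewrite /e' -(@sphere_mixed_moment i j) 1?eq_sym //.
    by rewrite mulrC mulKf // pnatr_eq0.
  move=> u; rewrite inE => Du; rewrite -mulr_sumr.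
  by rewrite (_ : \sum_j _ = 1) ?mulr1.
have dn : d%:R / 2 + n%:R != 0 :> R.
  by apply: lt0r_neq0; rewrite ltr_pwDl // divr_gt0 // ltr0n.
have n1 : (2 * n).+1%:R != 0 :> R by rewrite pnatr_eq0.
rewrite E; move: n1; rewrite -natr1 natrM => n1.
by field; rewrite n1 /=; apply: contraNneq dn => H; apply/eqP; lra.
Qed.

Lemma sphere_momentE i (j k : nat) :
  (\int[P]_(u in D) (tnth u i ^+ (2 * j) * (1 - tnth u i ^+ 2) ^+ k))%:C =
  sphere_moment R d j k.
Proof.
elim: k j => [|k IHk] j.
  under eq_Rintegral do rewrite mulr1.
  rewrite /sphere_moment addn0 pochhammer0 mulr1; elim: j => [|j IHj].
    under eq_Rintegral do rewrite expr0.
    rewrite Rintegral_cst // !pochhammer0 divr1 mul1r.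
    by rewrite [fine _](_ : _ = 1) // -[RHS]/(fine 1%E) -(sphere_measureP R d0).1.
  have E : ((1 / 2 + j%:R) / (d%:R / 2 + j%:R))%:C =
      (1 / 2 + j%:R) / (d%:R / 2 + j%:R) :> R[i].
    by rewrite fmorph_div !rmorphD !fmorph_div !rmorph_nat rmorph1.
  rewrite sphere_even_moment (rmorphM (real_complex R)) /= E IHj !pochhammerS.
  by rewrite mulf_div [_ * pochhammer _ j]mulrC [_ * pochhammer (d%:R / 2) j]mulrC.
rewrite sphere_momentS // -!IHk -rmorphB; congr _%:C.
have b1 l : bmeasurable D (fun u : d.-tuple R => tnth u i ^+ (2 * l) * (1 - tnth u i ^+ 2) ^+ k).
  apply: bmeasurableM; apply: bmeasurableX; first exact: bmeasurable_coord.
  exact: bmeasurable_one_sub_sqr.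
rewrite -RintegralB //; try exact: bmeasurable_integrable.
apply: eq_Rintegral => u _; rewrite exprS mulnS exprD; ring.
Qed.

End sphere_moments.

(** * Summation of the Horn series *)

Section zonal_series.
Variable R : realType.
Implicit Types (a : R[i]) (p q : nat) (T : R).

Lemma normc_pochhammer_le (a b : R[i]) n :
  (forall i, normc (a + i%:R) <= normc (b + i%:R)) ->
  normc (pochhammer a n) <= normc (pochhammer b n).
Proof.
move=> H; elim: n => [|n IHn]; first by rewrite !pochhammer0.
by rewrite !pochhammerS !normcM ler_pM ?normc_ge0.
Qed.

Lemma half_pochhammer_growth a d (rho : R) : (0 < d)%N -> 1 < rho ->
  exists2 M : R, 0 <= M & forall n,
    normc (pochhammer a n / pochhammer (d%:R / 2) n) <= M * rho ^+ n.
Proof.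
by move=> d0 rho1; rewrite half_natr; apply: pochhammer_growth => //; rewrite divr_gt0 ?ltr0n.
Qed.

Lemma fact_pochhammer_growth a (rho : R) : 1 < rho ->
  exists2 M : R, 0 <= M & forall n, normc (pochhammer a n / n`!%:R) <= M * rho ^+ n.
Proof.
move=> rho1; have [M M0 HM] := @pochhammer_growth R a 1 rho ltr01 rho1.
by exists M => // n; rewrite -pochhammer1; exact: HM.
Qed.

(** The coefficient is a product of four quotients of Pochhammer symbols of equal length, each
    bounded by a multiple of a power of [rho]; the exponents add up to 3m + 2n <= 4 (m + n). *)
Lemma horn_coef_summable a p q T : (0 < p)%N -> (0 < q)%N -> 0 <= T < 1 ->
  abs_summable (fun m n => horn_coef a p q m n * (T ^+ (m + n))%:C).
Proof.
move=> p0 q0 T01; have [T0 T1] := andP T01; have [rho rho1 Hrho] := expr4_lt T01.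
have [M1 M10 H1] := half_pochhammer_growth a p0 rho1.
have [M2 M20 H2] := fact_pochhammer_growth (1 + a - q%:R / 2) rho1.
have [M3 M30 H3] := fact_pochhammer_growth (q%:R / 2 - a) rho1.
have [M4 M40 H4] := half_pochhammer_growth (1 / 2) q0 rho1.
apply: (@abs_summable_geometric _ _ (M1 * M2 * M3 * M4) _ Hrho) => m n.
have -> : horn_coef a p q m n = pochhammer a m / pochhammer (p%:R / 2) m *
    (pochhammer (1 + a - q%:R / 2) m / m`!%:R) * (pochhammer (q%:R / 2 - a) n / n`!%:R) *
    (pochhammer (1 / 2) (m + n) / pochhammer (q%:R / 2) (m + n)).
  by rewrite /horn_coef !invfM; ring.
rewrite normcM normcR ger0_norm ?exprn_ge0 // exprMn [leRHS]mulrA ler_wpM2r ?exprn_ge0 //.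
apply: (@le_trans _ _ (M1 * rho ^+ m * (M2 * rho ^+ m) * (M3 * rho ^+ n) * (M4 * rho ^+ (m + n)))).
  by rewrite normcM ler_pM ?normc_ge0 // normcM ler_pM ?normc_ge0 // normcM ler_pM ?normc_ge0.
rewrite (_ : _ * _ = M1 * M2 * M3 * M4 * (rho ^+ m * rho ^+ m * rho ^+ n * rho ^+ (m + n))).
  2: by ring.
rewrite ler_wpM2l ?mulr_ge0 // -!exprD -exprM ler_weXn2l //; [lra|lia].
Qed.

(** The symbol (a + k + 1/2)_j is shifted by k, so the growth bound does not apply to it directly.
    With A = |a| + 1/2 it is dominated by (A + k)_j = (A)_(j+k) / (A)_k; then (A)_(j+k) is paired
    with (q/2)_(j+k), and ((q - 1)/2)_k with (A)_k. *)
Lemma zonal_coef_summable a p q T : (0 < p)%N -> (0 < q)%N -> 0 <= T < 1 ->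
  abs_summable (fun j k => zonal_coef a p q k j * (T ^+ (k + j))%:C).
Proof.
move=> p0 q0 T01; have [T0 T1] := andP T01; have [rho rho1 Hrho] := expr4_lt T01.
pose A := normc a + 1 / 2.
have A0 : 0 < A by rewrite /A ltr_wpDl ?normc_ge0 // divr_gt0.
have [M1 M10 H1] := half_pochhammer_growth a p0 rho1.
have [M2 M20 H2] := half_pochhammer_growth A%:C q0 rho1.
have [M3 M30 H3] := fact_pochhammer_growth (1 / 2) rho1.
have [M4 M40 H4] := fact_pochhammer_growth ((p%:R - 1) / 2) rho1.
have [M5 M50 H5] := pochhammer_growth ((q%:R - 1) / 2) A0 rho1.
apply: (@abs_summable_geometric _ _ (M1 * M2 * M3 * M4 * M5) _ Hrho) => j k.
have le4 : (j + k + (j + k) + k + j + k <= 4 * (j + k))%N.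
  by clear; lia.
rewrite normcM normcR ger0_norm ?exprn_ge0 // [(k + j)%N]addnC exprMn [leRHS]mulrA.
rewrite ler_wpM2r ?exprn_ge0 //.
have Ak : pochhammer A%:C k != 0.
  by apply: pochhammer_neq0 => i; rewrite -(rmorph_nat (real_complex R)) -rmorphD fmorph_eq0 gt_eqF // ltr_pwDl.
have E : normc (pochhammer (a + k%:R + 1 / 2) j) <= normc (pochhammer (A%:C + k%:R) j).
  apply: normc_pochhammer_le => i.
  have -> : A%:C + k%:R + i%:R = (A + k%:R + i%:R)%:C :> R[i].
    by rewrite !rmorphD /= !rmorph_nat.
  have Ai0 : 0 <= A + k%:R + i%:R by apply: addr_ge0 => //; apply: addr_ge0 => //; exact: ltW.
  rewrite normcR (ger0_norm Ai0).
  have -> : a + k%:R + 1 / 2 + i%:R = a + (1 / 2 + k%:R + i%:R)%:C :> R[i].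
    by rewrite !rmorphD rmorphM fmorphV rmorph1 !rmorph_nat; ring.
  apply: le_trans (le_normcD _ _) _; rewrite normcR ger0_norm ?addr_ge0 //.
  by rewrite /A; lra.
have -> : zonal_coef a p q k j = pochhammer a (j + k) / pochhammer (p%:R / 2) (j + k) *
    (pochhammer (a + k%:R + 1 / 2) j * (pochhammer ((q%:R - 1) / 2) k /
      pochhammer (q%:R / 2) (j + k))) *
    (pochhammer (1 / 2) j / j`!%:R) * (pochhammer ((p%:R - 1) / 2) k / k`!%:R).
  rewrite zonal_coefE /sphere_moment [(k + j)%N]addnC.
  have h0 := half_pochhammer1_neq0 R j.
  have ? := fact_neq0 R k; have ? := fact_neq0 R j.
  have ? := half_pochhammer_neq0 R (j + k) p0.
  have ? := half_pochhammer_neq0 R (j + k) q0.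
  by field; do !(apply/andP; split).
have E2 : normc (pochhammer (a + k%:R + 1 / 2) j * (pochhammer ((q%:R - 1) / 2) k /
      pochhammer (q%:R / 2) (j + k))) <= M2 * rho ^+ (j + k) * (M5 * rho ^+ k).
  apply: (@le_trans _ _ (normc (pochhammer A%:C (j + k) / pochhammer (q%:R / 2) (j + k)) *
      normc (pochhammer ((q%:R - 1) / 2) k / pochhammer A%:C k))).
    rewrite -normcM.
    have -> : pochhammer A%:C (j + k) / pochhammer (q%:R / 2) (j + k) *
        (pochhammer ((q%:R - 1) / 2) k / pochhammer A%:C k) = pochhammer (A%:C + k%:R) j *
        (pochhammer ((q%:R - 1) / 2) k / pochhammer (q%:R / 2) (j + k)).
      have ? := half_pochhammer_neq0 R (j + k) q0.
      have -> : pochhammer A%:C (j + k) = pochhammer A%:C k * pochhammer (A%:C + k%:R) j.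
        by rewrite addnC pochhammerD.
      by field; do !(apply/andP; split).
    by rewrite normcM [leRHS]normcM ler_wpM2r ?normc_ge0.
  by rewrite ler_pM ?normc_ge0.
apply: (@le_trans _ _ (M1 * rho ^+ (j + k) * (M2 * rho ^+ (j + k) * (M5 * rho ^+ k)) *
   (M3 * rho ^+ j) * (M4 * rho ^+ k))).
  rewrite normcM ler_pM ?normc_ge0 // normcM ler_pM ?normc_ge0 // normcM ler_pM ?normc_ge0 //.
rewrite (_ : _ * _ = M1 * M2 * M3 * M4 * M5 *
   (rho ^+ (j + k) * rho ^+ (j + k) * rho ^+ k * rho ^+ j * rho ^+ k)); last by ring.
apply: ler_wpM2l; first by apply: mulr_ge0 => //; apply: mulr_ge0 => //; rewrite !mulr_ge0.
rewrite -!exprD -exprM; apply: ler_weXn2l; [exact: ltW|exact: le4].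
Qed.

Lemma binomial_summable a T : 0 <= T < 1 ->
  exists M : R, forall n, \sum_(i < n) normc (pochhammer a i / i`!%:R * (T ^+ i)%:C) <= M.
Proof.
move=> T01; have [T0 T1] := andP T01; have [rho rho1 /andP[r0 r1]] := expr4_lt T01.
have [M M0 HM] := fact_pochhammer_growth a rho1.
exists (M * (1 - rho ^+ 4 * T)^-1) => n.
apply: (@le_trans _ _ (\sum_(i < n) M * (rho ^+ 4 * T) ^+ i)).
  apply: ler_sum => i _; rewrite normcM normcR ger0_norm ?exprn_ge0 // exprMn [leRHS]mulrA.
  rewrite ler_wpM2r ?exprn_ge0 //; apply: le_trans (HM i) _.
  rewrite ler_wpM2l // -exprM ler_weXn2l //; [lra|lia].
by rewrite -mulr_sumr ler_wpM2l // sum_expr_le // r0.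
Qed.

(** [V] lists the diagonal sums of the given series and [b] the terms of a binomial series. The
    products [V L * b i] sum to [S * B] over squares, and by [sum_horn_coef] their diagonal sums are
    those of the Horn series, whose absolute summability upgrades this to unconditional
    convergence. *)
Lemma horn_sums_to a p q T S : (0 < p)%N -> (0 < q)%N -> 0 <= T < 1 ->
  sums_to (fun j k => zonal_coef a p q k j * (T ^+ (k + j))%:C) S ->
  sums_to (fun m n => horn_coef a p q m n * (T ^+ (m + n))%:C) (S * cpow (1 - T) (a - 1 / 2)).
Proof.
move=> p0 q0 T01 HS; have [T0 T1] := andP T01.
set w := fun j k => _ in HS.
pose V L := \sum_(j < L.+1) w j (L - j)%N.
pose b i := pochhammer (1 / 2 - a) i / i`!%:R * (T ^+ i)%:C.
set B := cpow (1 - T) (a - 1 / 2).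
have [Mb Hb] := binomial_summable (1 / 2 - a) T01.
have [Mw Hw] := zonal_coef_summable a p0 q0 T01.
have HV n : \sum_(L < n) normc (V L) <= Mw.
  apply: le_trans (Hw n); rewrite -/w.
  apply: (@le_trans _ _ (\sum_(L < n) \sum_(j < L.+1) normc (w j (L - j)%N))).
    by apply: ler_sum => L _; exact: normc_sum.
  rewrite (sum_triangle (fun i j => normc (w i j))); apply: ler_sum => i _.
  rewrite big_mkcond; apply: ler_sum => j _.
  by case: ifP => // _; exact: normc_ge0.
have su : abs_summable (fun L i => V L * b i).
  exists (Mw * Mb) => n; rewrite (eq_bigr (fun L : 'I_n =>
      normc (V L) * \sum_(i < n) normc (b i))); last first.
    by move=> L _; rewrite mulr_sumr; apply: eq_bigr => i _; rewrite normcM.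
  by rewrite -mulr_suml ler_pM ?HV ?Hb // sumr_ge0 // => *; exact: normc_ge0.
have HVB : sums_to (fun L i => V L * b i) (S * B).
  apply: sums_to_rect => // e n0 e0.
  (* Fitted to X Y - S B = (X - S) Y + S (Y - B) with [normc Y] at most |Mb|; the summand 1 keeps
     the denominator positive. *)
  pose d := e / 2 / (1 + normc S + `|Mb|).
  have d0 : 0 < d by rewrite !divr_gt0 // ltr_pwDl // ltr_pwDl // normc_ge0.
  have [n1 H1] := sums_to_triangle HS d0.
  have rT : 0 <= T < 1 by [].
  have [n2 H2] := binomial_uniform (1 / 2 - a) rT d0.
  pose n := maxn n0 (maxn n1 n2).
  exists n, n; split; rewrite ?leq_maxl //.
  have := H1 n (leq_trans (leq_maxl n1 n2) (leq_maxr _ _)).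
  have := H2 n (leq_trans (leq_maxr n1 n2) (leq_maxr _ _)) T.
  rewrite ger0_norm // => /(_ (lexx _)).
  rewrite (_ : - (1 / 2 - a) = a - 1 / 2) ?opprB // -/B.
  have -> : \sum_(i < n) \sum_(j < n) V i * b j =
      (\sum_(L < n) V L) * binomial_sum (1 / 2 - a) n T.
    by rewrite mulr_suml; apply: eq_bigr => L _; rewrite mulr_sumr.
  rewrite -/(V _); set X := \sum_(L < n) V L; set Y := binomial_sum _ _ _ => HY HX.
  have HYb : normc Y <= `|Mb|.
    by apply: le_trans (ler_norm _); apply: le_trans (Hb n); exact: normc_sum.
  have -> : X * Y - S * B = (X - S) * Y + S * (Y - B) by ring.
  apply: le_trans (le_normcD _ _) _; rewrite !normcM.
  apply: (@le_trans _ _ (d * `|Mb| + normc S * d)).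
    by rewrite lerD // ler_pM ?normc_ge0.
  apply: (@le_trans _ _ (e / 2)); last by lra.
  have K0 : 0 < 1 + normc S + `|Mb| by rewrite ltr_pwDl // ltr_pwDl // normc_ge0.
  rewrite [normc S * d]mulrC -mulrDr /d -mulrA; apply: ler_piMr; first by lra.
  by rewrite mulrC ler_pdivrMr // mul1r; lra.
apply: triangle_sums_to; first exact: horn_coef_summable.
move=> e e0; have [n0 Hn0] := sums_to_triangle HVB e0.
exists n0 => n n0n; rewrite (_ : \sum_(N < n) _ = \sum_(N < n) \sum_(L < N.+1) V L * b (N - L)%N).
  exact: Hn0.
apply: eq_bigr => N _.
rewrite (eq_bigr (fun m : 'I_N.+1 => horn_coef a p q m (N - m) * (T ^+ N)%:C)); last first.
  by move=> m _; rewrite subnKC // -ltnS.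
rewrite -mulr_suml sum_horn_coef // mulr_suml; apply: eq_bigr => L _.
have LN : (L <= N)%N by rewrite -ltnS.
have -> : V L = (\sum_(j < L.+1) zonal_coef a p q (L - j) j) * (T ^+ L)%:C.
  rewrite mulr_suml; apply: eq_bigr => j _.
  by rewrite /w subnK // -ltnS.
have -> : T ^+ N = T ^+ L * T ^+ (N - L) by rewrite -exprD subnKC.
by rewrite /b rmorphM; ring.
Qed.

End zonal_series.

(** * The zonal spherical function *)

Section zonal_expansion.
Variable R : realType.
Implicit Types (a : R[i]) (alpha : R).

Lemma tanh_lt1 alpha : `|tanh alpha| < 1.
Proof.
have c0 := cosh_gt0 alpha; rewrite /tanh normrM normfV (gtr0_norm c0) ltr_pdivrMr // mul1r.
by rewrite ltr_norml /cosh /sinh; apply/andP; split; have := expR_gt0 alpha;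
  have := expR_gt0 (- alpha); lra.
Qed.

Lemma tanh2_cosh2 alpha : (1 - tanh alpha ^+ 2) * cosh alpha ^+ 2 = 1.
Proof.
have c0 : cosh alpha != 0 by rewrite gt_eqF // cosh_gt0.
rewrite -[RHS](cosh2_sinh2 alpha) /tanh; move: (cosh alpha) (sinh alpha) c0 => c h c0.
by field.
Qed.

Lemma Lambda_tanh alpha (x y : R) : Lambda alpha x y = cosh alpha ^+ 2 *
  ((1 - tanh alpha * (y * x)) ^+ 2 - tanh alpha ^+ 2 * ((1 - y ^+ 2) * (1 - x ^+ 2))).
Proof.
have c0 : cosh alpha != 0 by rewrite gt_eqF // cosh_gt0.
rewrite (_ : Lambda alpha x y = (cosh alpha ^+ 2 - sinh alpha ^+ 2) +
  (x ^+ 2 + y ^+ 2) * sinh alpha ^+ 2 - 2 * x * y * sinh alpha * cosh alpha); last first.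
  by rewrite cosh2_sinh2.
by rewrite /tanh; move: (cosh alpha) (sinh alpha) c0 => c h c0; field.
Qed.

Lemma cpow_Lambda a alpha (x y : R) : x ^+ 2 <= 1 -> y ^+ 2 <= 1 ->
  cpow (Lambda alpha x y) (- a) =
  cpow (cosh alpha ^+ 2) (- a) * zonal_kernel a (tanh alpha) y x.
Proof.
move=> x1 y1; have := Lambda_gt0 alpha x1 y1; rewrite Lambda_tanh => L0.
have c0 : 0 < cosh alpha ^+ 2 by rewrite exprn_gt0 // cosh_gt0.
by rewrite cpowM // -(pmulr_rgt0 _ c0).
Qed.

Lemma sum_double (V : nmodType) (f : nat -> V) J :
  \sum_(j < 2 * J) f j = \sum_(j < J) (f (2 * j)%N + f (2 * j).+1).
Proof.
elim: J => [|J IHJ]; first by rewrite muln0 !big_ord0.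
by rewrite mulnS !addSn add0n !big_ord_recr /= IHJ addrA.
Qed.

(** Only even powers of a coordinate survive integration, so [2 * J] terms in the inner expansion
    leave [J]; the moments turn the integrated approximation of the kernel into a rectangular
    partial sum. *)
Lemma zonal_sums_to p q a alpha :
  sums_to (fun j k => zonal_coef a p.+1 q.+1 k j * ((tanh alpha ^+ 2) ^+ (k + j))%:C)
    (cpow (cosh alpha ^+ 2) a * zonal_spherical p.+1 q.+1 (- (2 * a)) alpha).
Proof.
set t := tanh alpha; set c2 := cosh alpha ^+ 2.
have t1 : `|t| < 1 := tanh_lt1 alpha.
have T01 : 0 <= t ^+ 2 < 1.
  by rewrite sqr_ge0 -real_normK ?num_real // exprn_ilt1 // ?normr_ge0.
apply: sums_to_rect; first exact: zonal_coef_summable.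
move=> e n0 e0.
pose f (kj : nat * nat) (u : q.+1.-tuple R) :=
  tnth u ord0 ^+ kj.2 * (1 - tnth u ord0 ^+ 2) ^+ kj.1.
pose g (kj : nat * nat) (v : p.+1.-tuple R) :=
  tnth v ord_max ^+ kj.2 * (1 - tnth v ord_max ^+ 2) ^+ kj.1.
pose F (u : q.+1.-tuple R) (v : p.+1.-tuple R) :=
  cpow (Lambda alpha (tnth v ord_max) (tnth u ord0)) (- a).
pose idx K J := [seq (k, j) | k <- iota 0 K, j <- iota 0 (2 * J)].
pose C (kj : nat * nat) : R[i] := pochhammer a kj.1 / kj.1`!%:R *
  (pochhammer (2 * a + (2 * kj.1)%:R) kj.2 / kj.2`!%:R) * ((t ^+ 2) ^+ kj.1 * t ^+ kj.2)%:C.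
have coord n (u : n.+1.-tuple R) i : sphere R n.+1 u -> `|tnth u i| <= 1.
  exact: sphere_coord_le1.
have b1 n (i : 'I_n.+1) (kj : nat * nat) : bmeasurable (sphere R n.+1)
    (fun u => tnth u i ^+ kj.2 * (1 - tnth u i ^+ 2) ^+ kj.1).
  apply: bmeasurableM; apply: bmeasurableX; first exact: bmeasurable_coord.
  exact: bmeasurable_one_sub_sqr.
have rM (r s : R) : (r * s)%:C = r%:C * s%:C :> R[i] by exact: rmorphM.
have approx (e' : R) n1 : 0 < e' -> exists K J, [/\ (n1 <= K)%N, (n1 <= J)%N &
    forall u v, sphere R q.+1 u -> sphere R p.+1 v -> normc (\sum_(kj <- idx K J)
      cpow c2 (- a) * C kj * (f kj u * g kj v)%:C - F u v) <= e'].
  move=> e'0; pose e1 := e' / normc (cpow c2 (- a)).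
  have e10 : 0 < e1 by rewrite divr_gt0 // normc_cpow expR_gt0.
  have [K [J [nK nJ H]]] := zonal_kernel_approx a n1 t1 e10.
  exists K, J; split => // u v Du Dv.
  have := H _ _ (coord _ _ ord0 Du) (coord _ _ ord_max Dv).
  rewrite /e1 ler_pdivlMr ?normc_cpow ?expR_gt0 // -normc_cpow mulrC -normcM.
  rewrite /F cpow_Lambda; first last.
  - by rewrite -real_normK ?num_real // exprn_ile1 // coord.
  - by rewrite -real_normK ?num_real // exprn_ile1 // coord.
  rewrite mulrBr; congr (normc (_ - _) <= _).
  rewrite big_allpairs mulr_sumr -[X in iota _ X]subn0 -/(index_iota 0 K) big_mkord.
  apply: eq_bigr => k _; rewrite mulr_sumr -[X in iota _ X]subn0 -/(index_iota 0 _) big_mkord.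
  apply: eq_bigr => j _.
  by rewrite /C /f /g !rM /=; ring.
(* The factor 1/2 absorbs the doubled error of [cintegral2_approx], the division the final
   multiplication by [cpow c2 a]. *)
have e4 : 0 < e / 2 / normc (cpow c2 a) by rewrite !divr_gt0 // normc_cpow expR_gt0.
have [K [J [nK nJ H]]] := approx _ n0 e4.
exists J, K; split => //.
have e0' : 0 <= e / 2 / normc (cpow c2 a) by exact: ltW.
have HF (e' : R) : 0 < e' -> exists r c, forall u v, sphere R q.+1 u -> sphere R p.+1 v ->
    normc (\sum_(kj <- r) c kj * (f kj u * g kj v)%:C - F u v) <= e'.
  move=> /(approx _ 0)[K' [J' [_ _ H']]].
  by exists (idx K' J'), (fun kj => cpow c2 (- a) * C kj).
have := cintegral2_approx (sphere_measure R q.+1) (sphere_measure R p.+1)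
  (@measurable_sphere R q.+1) (@measurable_sphere R p.+1)
  (b1 _ ord0) (b1 _ ord_max) HF e0' H.
set S := (X in normc (X - _)); set Z := (X in normc (_ - X)) => HS.
have -> : zonal_spherical p.+1 q.+1 (- (2 * a)) alpha = Z.
  rewrite zonal_spherical_explicit (_ : - (2 * a) / 2 = - a) //.
  by rewrite mulNr mulrC mulKf // pnatr_eq0.
have SE : cpow c2 a * S = \sum_(j < J) \sum_(k < K)
    zonal_coef a p.+1 q.+1 k j * ((t ^+ 2) ^+ (k + j))%:C.
  rewrite exchange_big /S big_allpairs mulr_sumr -[X in iota _ X]subn0 -/(index_iota 0 K) big_mkord.
  apply: eq_bigr => k _; rewrite -[X in iota _ X]subn0 -/(index_iota 0 _) big_mkord.
  pose h j := cpow c2 (- a) * C (k : nat, j) *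
    ((\int[sphere_measure R q.+1]_(u in sphere R q.+1) f (k : nat, j) u) *
     \int[sphere_measure R p.+1]_(v in sphere R p.+1) g (k : nat, j) v)%:C.
  rewrite -[X in _ * X = _]/(\sum_(j < 2 * J) h j) sum_double mulr_sumr.
  apply: eq_bigr => j _; rewrite /h.
  rewrite [X in _ + _ * X%:C](_ : _ = 0); last first.
    by rewrite /f /= sphere_odd_moment ?mul0r //= mul2n odd_double.
  rewrite mulr0 addr0 rM /f /g /= !sphere_momentE // /C /= /zonal_coef.
  rewrite (_ : (t ^+ 2) ^+ k * t ^+ (2 * j) = (t ^+ 2) ^+ (k + j)); last first.
    by rewrite [t ^+ (2 * j)]exprM -exprD.
  move: (cpow c2 (- a)) (cpow c2 a) (cpowNK c2 a) => P Q PQ.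
  by rewrite -[RHS]mul1r -PQ; ring.
rewrite -SE -mulrBr normcM.
have K0 : 0 < normc (cpow c2 a) by rewrite normc_cpow expR_gt0.
apply: le_trans (ler_wpM2l (ltW K0) HS) _.
by rewrite -mulrDl -splitr mulrC divfK // gt_eqF.
Qed.

(** 1 - tanh^2 is inverse to cosh^2, so the powers of exponent a - 1/2 cancel and (cosh^2)^(1/2)
    remains. *)
Lemma cpow_cosh_tanh a alpha :
  cpow (cosh alpha ^+ 2) a * cpow (1 - tanh alpha ^+ 2) (a - 1 / 2) = (cosh alpha)%:C.
Proof.
have c0 := cosh_gt0 alpha; have c20 : 0 < cosh alpha ^+ 2 by rewrite exprn_gt0.
have T0 : 0 < 1 - tanh alpha ^+ 2.
  by rewrite -(pmulr_lgt0 _ c20) tanh2_cosh2.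
have E b : cpow (cosh alpha ^+ 2) b * cpow (1 - tanh alpha ^+ 2) b = 1.
  by rewrite -cpowM // mulrC tanh2_cosh2 cpow1.
have -> : cpow (cosh alpha ^+ 2) a =
    cpow (cosh alpha ^+ 2) (a - 1 / 2) * cpow (cosh alpha ^+ 2) (1 / 2).
  by rewrite -cpowD subrK.
rewrite mulrAC E -cpow_sqrt // sqrtr_sqr gtr0_norm // cpow_nat1 //.
by rewrite mul1r.
Qed.

(** [Z] is arbitrary, so that the lemma also applies with p and q exchanged while [Z] remains the
    function of SO_0(p, q). *)
Lemma zonal_horn_has_sum p q a alpha Z : (0 < p)%N -> (0 < q)%N ->
  sums_to (fun j k => zonal_coef a p q k j * ((tanh alpha ^+ 2) ^+ (k + j))%:C)
    (cpow (cosh alpha ^+ 2) a * Z) ->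
  exists2 S, has_sum (fun mn : nat * nat =>
     horn_coef a p q mn.1 mn.2 * ((tanh alpha ^+ 2) ^+ (mn.1 + mn.2))%:C) S &
    Z = ((cosh alpha)^-1)%:C * S.
Proof.
move=> p0 q0 H; have T01 : 0 <= tanh alpha ^+ 2 < 1.
  by rewrite sqr_ge0 -real_normK ?num_real // exprn_ilt1 // ?normr_ge0 // tanh_lt1.
exists (cpow (cosh alpha ^+ 2) a * Z * cpow (1 - tanh alpha ^+ 2) (a - 1 / 2)).
  exact: sums_to_has_sum (horn_sums_to p0 q0 T01 H).
have cE := cpow_cosh_tanh a alpha; move: (cpow _ a) (cpow _ (a - _)) cE => P Q cE.
have -> : P * Z * Q = P * Q * Z by ring.
by rewrite cE fmorphV mulKf // fmorph_eq0 gt_eqF // cosh_gt0.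
Qed.

End zonal_expansion.

Lemma horn_coef_half (R : realType) (sigma : R[i]) p q (T : R) m n :
  horn_coef (- (sigma / 2)) p q m n * (T ^+ (m + n))%:C =
  pochhammer (- (sigma / 2)) m * pochhammer (1 - (sigma + q%:R) / 2) m
    * pochhammer ((sigma + q%:R) / 2) n * pochhammer (1 / 2) (m + n)
  / (pochhammer (q%:R / 2) (m + n) * pochhammer (p%:R / 2) m)
  * (T%:C ^+ m / m`!%:R) * (T%:C ^+ n / n`!%:R).
Proof.
rewrite /horn_coef (_ : 1 + - (sigma / 2) - q%:R / 2 = 1 - (sigma + q%:R) / 2); last by ring.
rewrite (_ : q%:R / 2 - - (sigma / 2) = (sigma + q%:R) / 2); last by ring.
by rewrite rmorphXn exprD !invfM; ring.
Qed.

Theorem theorem3p1 (R : realType) (p q : nat) (hp : (2 <= p)%N) (hq : (1 <= q)%N)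
    (sigma : R[i]) (alpha : R) :
  (exists2 S : R[i],
     has_sum (fun mn : nat * nat =>
       let m := mn.1 in let n := mn.2 in
       pochhammer (- (sigma / 2)) m * pochhammer (1 - (sigma + q%:R) / 2) m
         * pochhammer ((sigma + q%:R) / 2) n * pochhammer (1 / 2) (m + n)
       / (pochhammer (q%:R / 2) (m + n) * pochhammer (p%:R / 2) m)
       * ((tanh alpha ^+ 2)%:C ^+ m / m`!%:R)
       * ((tanh alpha ^+ 2)%:C ^+ n / n`!%:R)) S
   & zonal_spherical p q sigma alpha = ((cosh alpha)^-1)%:C * S)
  /\
  (exists2 S : R[i],
     has_sum (fun mn : nat * nat =>
       let m := mn.1 in let n := mn.2 in
       pochhammer (- (sigma / 2)) m * pochhammer (1 - (sigma + p%:R) / 2) m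
         * pochhammer ((sigma + p%:R) / 2) n * pochhammer (1 / 2) (m + n)
       / (pochhammer (p%:R / 2) (m + n) * pochhammer (q%:R / 2) m)
       * ((tanh alpha ^+ 2)%:C ^+ m / m`!%:R)
       * ((tanh alpha ^+ 2)%:C ^+ n / n`!%:R)) S
   & zonal_spherical p q sigma alpha = ((cosh alpha)^-1)%:C * S).
Proof.
have H : sums_to (fun j k => zonal_coef (- (sigma / 2)) p q k j * ((tanh alpha ^+ 2) ^+ (k + j))%:C)
    (cpow (cosh alpha ^+ 2) (- (sigma / 2)) * zonal_spherical p q sigma alpha).
  case: p hp q hq => // p _ [//|q] _.
  have := zonal_sums_to p q (- (sigma / 2)) alpha.
  by rewrite (_ : - (2 * - (sigma / 2)) = sigma) //; field.
have p0 : (0 < p)%N := ltnW hp; have q0 : (0 < q)%N := hq.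
split.
  have [S HS ZS] := zonal_horn_has_sum p0 q0 H; exists S => //.
  rewrite [X in has_sum X](_ : _ = fun mn : nat * nat => horn_coef (- (sigma / 2)) p q mn.1 mn.2 *
    ((tanh alpha ^+ 2) ^+ (mn.1 + mn.2))%:C) //.
  by apply/funext => mn; rewrite horn_coef_half.
(* By symmetry of [zonal_coef], the same function has the expansion with p and q exchanged. *)
have H' : sums_to (fun j k => zonal_coef (- (sigma / 2)) q p k j * ((tanh alpha ^+ 2) ^+ (k + j))%:C)
    (cpow (cosh alpha ^+ 2) (- (sigma / 2)) * zonal_spherical p q sigma alpha).
  rewrite [X in sums_to X](_ : _ = fun j k => zonal_coef (- (sigma / 2)) p q k j *
    ((tanh alpha ^+ 2) ^+ (k + j))%:C) //.
  by apply/funext => j; apply/funext => k; rewrite zonal_coefC.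
have [S HS ZS] := zonal_horn_has_sum q0 p0 H'; exists S => //.
rewrite [X in has_sum X](_ : _ = fun mn : nat * nat => horn_coef (- (sigma / 2)) q p mn.1 mn.2 *
  ((tanh alpha ^+ 2) ^+ (mn.1 + mn.2))%:C) //.
by apply/funext => mn; rewrite horn_coef_half.
Qed.
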